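(* Let $(\mathcal{A},\varphi,\psi)$ be a two-state non-commutative probability space and let $\Gamma=\{(\mathcal{A}_{k,\ell},\mathcal{A}_{k,r})\}_{k\in K}$ be a family of pairs of algebras in $(\mathcal{A},\varphi,\psi)$. Then $\Gamma$ is conditionally bi-free (c-bi-free) with respect to $(\varphi,\psi)$ if and only if $\Gamma$ is combinatorially c-bi-free with respect to $(\varphi,\psi)$.
   Context: **Two-state spaces.** A two-state non-commutative probability space is a triple $(\mathcal{A},\varphi,\psi)$ with $\mathcal{A}$ a complex unital algebra and $\varphi,\psi:\mathcal{A}\to\mathbb{C}$ unital linear functionals. A pair of algebras in it is an ordered pair $(\mathcal{A}_\ell,\mathcal{A}_r)$ of unital subalgebras of $\mathcal{A}$ (left algebra, right algebra). **c-bi-freeness.** A two-state vector space with a specified state-vector is $(\mathcal{X},\mathcal{X}^\circ,\xi,\varphi)$ where $\mathcal{X}$ is a complex vector space, $0\ne\xi\in\mathcal{X}$, $\mathcal{X}=\mathbb{C}\xi\oplus\mathcal{X}^\circ$, and $\varphi:\mathcal{X}\to\mathbb{C}$ is linear with $\varphi(\xi)=1$. Let $\psi:\mathcal{X}\to\mathbb{C}$ be the linear functional with $\psi(\xi)=1$ and $\ker\psi=\mathcal{X}^\circ$. On the algebra $\mathcal{L}(\mathcal{X})$ of linear operators put $\varphi_\xi(T)=\varphi(T\xi)$, $\psi_\xi(T)=\psi(T\xi)$. The c-free product $(\mathcal{X},\mathcal{X}^\circ,\xi,\varphi)=*_{k\in K}(\mathcal{X}_k,\mathcal{X}_k^\circ,\xi_k,\varphi_k)$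 is $\mathcal{X}=\mathbb{C}\xi\oplus\mathcal{X}^\circ$, $\mathcal{X}^\circ=\bigoplus_{n\ge1}\bigoplus_{k_1\ne k_2\neq\cdots\ne k_n}\mathcal{X}_{k_1}^\circ\otimes\cdots\otimes\mathcal{X}_{k_n}^\circ$ (consecutive indices distinct), with $\varphi(\xi)=1$ and $\varphi(x_1\otimes\cdots\otimes x_n)=\varphi_{k_1}(x_1)\cdots\varphi_{k_n}(x_n)$ for $x_i\in\mathcal{X}_{k_i}^\circ$. Let $\mathcal{X}(\ell,k)$ (resp. $\mathcal{X}(r,k)$) be the span of $\xi$ and the summands with $k_1\neq k$ (resp. $k_n\ne k$). With the natural identifications $V_k:\mathcal{X}_k\otimes\mathcal{X}(\ell,k)\to\mathcal{X}$ and $W_k:\mathcal{X}(r,k)\otimes\mathcal{X}_k\to\mathcal{X}$, define $\lambda_k(T)=V_k(T\otimes I)V_k^{-1}$ and $\rho_k(T)=W_k(I\otimes T)W_k^{-1}$ for $T\in\mathcal{L}(\mathcal{X}_k)$. The joint pair-distribution of $\{(\mathcal{A}_{k,\ell},\mathcal{A}_{k,r})\}_{k\in K}$ is the pair $(\varphi\circ\tau,\psi\circ\tau)$ of functionals on the free product $*_{k\in K}(\mathcal{A}_{k,\ell}*\mathcal{A}_{k,r})$, where $\tau$ is the unital homomorphism to $\mathcal{A}$ that is the identity on each $\mathcal{A}_{k,\ell}$ and $\mathcal{A}_{k,r}$. The family is c-bi-free with respect to $(\varphi,\psi)$ if there are two-state vector spaces with specified state-vectors $(\mathcal{X}_k,\mathcal{X}_k^\circ,\xi_k,\varphi_k)$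 and unital homomorphisms $\ell_k:\mathcal{A}_{k,\ell}\to\mathcal{L}(\mathcal{X}_k)$, $r_k:\mathcal{A}_{k,r}\to\mathcal{L}(\mathcal{X}_k)$ such that its joint pair-distribution equals that of $\{(\lambda_k\circ\ell_k(\mathcal{A}_{k,\ell}),\rho_k\circ r_k(\mathcal{A}_{k,r}))\}_{k\in K}$ in $(\mathcal{L}(\mathcal{X}),\varphi_\xi,\psi_\xi)$ (viewed as functionals on $*_{k}(\mathcal{A}_{k,\ell}*\mathcal{A}_{k,r})$ via these homomorphisms). **Bi-non-crossing partitions.** For $\chi:[n]\to\{\ell,r\}$ with $\chi^{-1}(\ell)=\{i_1<\cdots<i_p\}$, $\chi^{-1}(r)=\{i_{p+1}>\cdots>i_n\}$, let $\prec_\chi$ be the total order $i_1\prec_\chi\cdots\prec_\chi i_n$. $\mathcal{BNC}(\chi)$ is the set of partitions of $[n]$ that are non-crossing with respect to $\prec_\chi$. A block $V$ of $\pi\in\mathcal{BNC}(\chi)$ is interior if there is another block $W$ of $\pi$ with $\min_{\prec_\chi}W\prec_\chi\min_{\prec_\chi}V$ and $\max_{\prec_\chi}V\prec_\chi\max_{\prec_\chi}W$; otherwise it is exterior. **Cumulants.** For $V=\{v_1<\dots<v_m\}\subseteq[n]$, $(a_1,\dots,a_n)|_V=(a_{v_1},\dots,a_{v_m})$ and $\chi|_V$ is regarded as a map on $[m]$. The $(\ell,r)$-cumulants $\kappa_\chi:\mathcal{A}^n\to\mathbb{C}$ (with respect to $\psi$) and c-$(\ell,r)$-cumulants $\mathcal{K}_\chi:\mathcal{A}^n\to\mathbb{C}$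 (with respect to $(\varphi,\psi)$) are the multilinear functionals uniquely determined by, for all $n\geq 1$, $\chi$, $a_i\in\mathcal A$, $$\psi(a_1\cdots a_n)=\sum_{\pi\in\mathcal{BNC}(\chi)}\prod_{V\in\pi}\kappa_{\chi|_V}((a_1,\dots,a_n)|_V),$$ $$\varphi(a_1\cdots a_n)=\sum_{\pi\in\mathcal{BNC}(\chi)}\Big(\prod_{V\in\pi\text{ interior}}\kappa_{\chi|_V}((a_1,\dots,a_n)|_V)\Big)\Big(\prod_{V\in\pi\text{ exterior}}\mathcal{K}_{\chi|_V}((a_1,\dots,a_n)|_V)\Big).$$ **Combinatorial c-bi-freeness.** The family is combinatorially c-bi-free with respect to $(\varphi,\psi)$ if for all $n\ge2$, $\chi:[n]\to\{\ell,r\}$, $\omega:[n]\to K$ and $a_i\in\mathcal{A}_{\omega(i),\chi(i)}$, one has $\kappa_\chi(a_1,\dots,a_n)=\mathcal{K}_\chi(a_1,\dots,a_n)=0$ whenever $\omega$ is not constant. *)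

(* Defs.v *)
From HB Require Import structures.
From mathcomp Require Import all_boot all_order all_algebra.
From mathcomp Require Import generic_quotient ring_quotient.
From mathcomp Require Import boolp functions reals complex.
From mathcomp Require Import finmap monalg.

Set Implicit Arguments.
Unset Strict Implicit.
Unset Printing Implicit Defensive.

Import GRing.Theory.

Local Open Scope ring_scope.
Local Open Scope quotient_scope.

Section Span.
Variables (C : fieldType) (V : lmodType C) (P : V -> Prop).

Inductive lspan : V -> Prop :=
| lspan0 : lspan 0
| lspanP c x y : P x -> lspan y -> lspan (c *: x + y).

Lemma lspan_gen x : P x -> lspan x.
Proof. by move=> Px; rewrite -[x]addr0 -[x]scale1r; apply: lspanP => //; apply: lspan0. Qed.

Lemma lspanD x y : lspan x -> lspan y -> lspan (x + y).
Proof.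
move=> sx sy; elim: sx => [|c u v Pu _ IH]; first by rewrite add0r.
by rewrite -addrA; apply: lspanP.
Qed.

Lemma lspanZ c x : lspan x -> lspan (c *: x).
Proof.
elim=> [|d u v Pu _ IH]; first by rewrite scaler0; apply: lspan0.
by rewrite scalerDr scalerA; apply: lspanP.
Qed.

Lemma lspanB x y : lspan x -> lspan y -> lspan (x - y).
Proof. by move=> sx sy; rewrite -scaleN1r; apply: lspanD => //; apply: lspanZ. Qed.

End Span.

(** The quotient of the free vector space on [W] by the linear span of [rel].
    [{ideal_quot _}] is the quotient by an additive subgroup: no ring structure
    on [{malg C[W]}] is involved. *)
Section Presented.
Variables (C : fieldType) (W : choiceType) (rel : {malg C[W]} -> Prop).
Local Notation M := {malg C[W]}.

Definition relspan : {pred M} := fun m => `[< lspan rel m >].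

Fact relspan_zmod : zmod_closed relspan.
Proof.
split; first by apply/asboolP; apply: lspan0.
by move=> x y /asboolP sx /asboolP sy; apply/asboolP; apply: lspanB.
Qed.
HB.instance Definition _ := GRing.isZmodClosed.Build M relspan relspan_zmod.

Definition presented : Type := {ideal_quot relspan}.
HB.instance Definition _ := GRing.Zmodule.on presented.

Definition pclass (m : M) : presented := \pi_{ideal_quot relspan} m.
Definition gen (w : W) : presented := pclass << w >>.

Lemma pclassP m m' : pclass m = pclass m' <-> lspan rel (m - m').
Proof.
split=> [/eqP|h]; last (apply/eqP); rewrite /pclass -Quotient.idealrBE.
  by move/asboolP.
exact/asboolP.
Qed.

Lemma pclassB m m' : pclass (m - m') = pclass m - pclass m'.
Proof. by rewrite /pclass !piE. Qed.

Lemma pclassD m m' : pclass (m + m') = pclass m + pclass m'.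
Proof. by rewrite /pclass !piE. Qed.

Lemma pclass_repr x : pclass (repr x) = x.
Proof. exact: reprK. Qed.

Definition pscale (c : C) (x : presented) : presented := pclass (c *: repr x).

Lemma pscaleE c m : pscale c (pclass m) = pclass (c *: m).
Proof.
apply/pclassP; rewrite -scalerBr; apply: lspanZ; apply/pclassP.
exact: pclass_repr.
Qed.

Fact pscaleA a b x : pscale a (pscale b x) = pscale (a * b) x.
Proof. by rewrite -(pclass_repr x) !pscaleE scalerA. Qed.
Fact pscale1 x : pscale 1 x = x.
Proof. by rewrite -[x in LHS]pclass_repr pscaleE scale1r pclass_repr. Qed.
Fact pscaleDr a : {morph pscale a : x y / x + y}.
Proof.
move=> x y; rewrite -(pclass_repr x) -(pclass_repr y) -pclassD !pscaleE.
by rewrite scalerDr pclassD.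
Qed.
Fact pscaleDl x : {morph pscale^~ x : a b / a + b}.
Proof. by move=> a b; rewrite -(pclass_repr x) !pscaleE scalerDl pclassD. Qed.
HB.instance Definition _ :=
  GRing.Zmodule_isLmodule.Build C presented pscaleA pscale1 pscaleDr pscaleDl.

Fact pclass_is_linear : linear pclass.
Proof. by move=> c m m'; rewrite pclassD -pscaleE. Qed.

HB.instance Definition _ :=
  GRing.isLinear.Build C M presented *:%R pclass pclass_is_linear.

(** Linear extension of a map on the generators to the free vector space, and
    the map it induces on [presented]; the latter is meaningful when the
    former kills the relations, see [pliftE]. *)
Definition free_lift (V : lmodType C) (f : W -> V) (m : M) : V :=
  \sum_(w <- msupp m) m@_w *: f w.

Definition plift (V : lmodType C) (f : W -> V) (x : presented) : V :=
  free_lift f (repr x).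

Section Lift.
Variables (V : lmodType C) (f : W -> V).

Lemma free_lift_is_linear : linear (free_lift f).
Proof.
move=> c m m'; pose d := (msupp m `|` msupp m')%fset.
have lift_w n : (msupp n `<=` d)%fset ->
    free_lift f n = \sum_(w <- d) n@_w *: f w.
  move=> sub; rewrite /free_lift (big_fset_incl _ sub) //= => w _ /mcoeff_outdom ->.
  by rewrite scale0r.
rewrite !lift_w ?fsubsetUl ?fsubsetUr //; last first.
  apply: fsubset_trans (msuppD_le _ _) _.
  by rewrite fsetSU // msuppZ_le.
rewrite scaler_sumr -big_split /=; apply: eq_bigr => w _.
by rewrite mcoeffD mcoeffZ scalerDl scalerA.
Qed.
HB.instance Definition _ :=
  GRing.isLinear.Build C M V *:%R (free_lift f) free_lift_is_linear.

Lemma free_lift1 w : free_lift f << w >> = f w.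
Proof.
by rewrite /free_lift msuppU oner_eq0 big_seq_fset1 mcoeffUU scale1r.
Qed.

Hypothesis f_rel : forall m, rel m -> free_lift f m = 0.

Lemma plift_pclass m : plift f (pclass m) = free_lift f m.
Proof.
have /pclassP: pclass (repr (pclass m)) = pclass m by exact: pclass_repr.
move=> h; apply/eqP; rewrite -subr_eq0 -linearB; apply/eqP.
by elim: h => [|c u v /f_rel fu _ IH]; rewrite ?linear0 // linearP /= fu IH scaler0 addr0.
Qed.

Lemma pliftE w : plift f (gen w) = f w.
Proof. by rewrite plift_pclass free_lift1. Qed.

Lemma plift_is_linear : linear (plift f).
Proof.
move=> c x y; rewrite -(pclass_repr x) -(pclass_repr y) -linearP.
by rewrite !plift_pclass linearP.
Qed.

End Lift.

Lemma presented_span (x : presented) : lspan (fun y => exists w, y = gen w) x.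
Proof.
rewrite -(pclass_repr x) (monalgE (repr x)) linear_sum.
elim/big_rec: _ => [|w y _ IH]; first exact: lspan0.
have -> : << (repr x)@_w *g w >> = (repr x)@_w *: << w >>.
  by apply/malgP => k; rewrite mcoeffZ !mcoeffU mulr_natr.
by rewrite linearZ; apply: lspanP => //; exists w.
Qed.

End Presented.

Record two_state_space (C : fieldType) := TwoStateSpace {
  ts_car :> lmodType C;
  ts_circ : {pred ts_car};
  ts_xi : ts_car;
  ts_phi : {scalar ts_car};
  ts_circ_submod : submod_closed ts_circ;
  ts_xi_neq0 : ts_xi != 0;
  (* the space is the direct sum of [C xi] and [circ] *)
  ts_direct : forall x, exists! c : C, x - c *: ts_xi \in ts_circ;
  ts_phi_xi : ts_phi ts_xi = 1
}.
Arguments ts_circ {C} t : rename.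
Arguments ts_xi {C} t : rename.
Arguments ts_phi {C} t : rename.

Section TwoStateTheory.
Variables (C : fieldType) (X : two_state_space C).
Local Notation xi := (ts_xi X).
Local Notation circ := (ts_circ X).

Fact ts_ex x : exists c : C, x - c *: xi \in circ.
Proof. by have [c [h _]] := ts_direct x; exists c. Qed.

(** The linear functional with value [1] at [xi] and kernel [circ]; see
    [ts_psi_xi] and [ts_psi_ker]. *)
Definition ts_psi (x : X) : C := xchoose (ts_ex x).
Definition ts_proj (x : X) : X := x - ts_psi x *: xi.

Lemma ts_proj_circ x : ts_proj x \in circ.
Proof. exact: (xchooseP (ts_ex x)). Qed.

Lemma ts_psi_uniq x c : x - c *: xi \in circ -> ts_psi x = c.
Proof.
have [d [_ u]] := ts_direct x; move=> /u <-.
by symmetry; apply: u; apply: ts_proj_circ.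
Qed.

Lemma ts_circ0 : 0 \in circ.
Proof. by have [] := ts_circ_submod X. Qed.

Lemma ts_circ_lin c x y : x \in circ -> y \in circ -> c *: x + y \in circ.
Proof. by have [_ h] := ts_circ_submod X; apply: h. Qed.

Fact ts_psi_is_linear : scalar ts_psi.
Proof.
move=> c x y; apply: ts_psi_uniq.
have -> : c *: x + y - (c * ts_psi x + ts_psi y) *: xi
        = c *: ts_proj x + ts_proj y.
  by rewrite /ts_proj scalerBr scalerA scalerDl opprD addrACA.
by apply: ts_circ_lin; apply: ts_proj_circ.
Qed.
HB.instance Definition _ :=
  GRing.isLinear.Build C X C *%R ts_psi ts_psi_is_linear.

Lemma ts_psi_xi : ts_psi xi = 1.
Proof. by apply: ts_psi_uniq; rewrite scale1r subrr ts_circ0. Qed.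

Lemma ts_psi_ker x : (ts_psi x == 0) = (x \in circ).
Proof.
apply/eqP/idP => [h|xc]; last by apply: ts_psi_uniq; rewrite scale0r subr0.
by have := ts_proj_circ x; rewrite /ts_proj h scale0r subr0.
Qed.

Fact ts_proj_is_linear : linear ts_proj.
Proof.
move=> c x y.
by rewrite /ts_proj linearP /= scalerBr scalerA scalerDl opprD addrACA.
Qed.
HB.instance Definition _ :=
  GRing.isLinear.Build C X X *:%R ts_proj ts_proj_is_linear.

Lemma ts_projE x : x = ts_psi x *: xi + ts_proj x.
Proof. by rewrite addrC subrK. Qed.

End TwoStateTheory.

(** The c-free product.  A word [x_1; ...; x_n] with [x_i] in the space
    [ts_circ (X k_i)] and [k_i != k_(i+1)] stands for the elementary tensor of
    the [x_i], and the empty word for the state-vector.  Taking all words as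
    generators and multilinearity as relations yields the direct sum of [C xi]
    and of the tensor products. *)
Section CFree.
Variables (C : fieldType) (K : choiceType) (X : K -> two_state_space C).

Definition letter := {k : K & X k}.
HB.instance Definition _ := Choice.on letter.
Definition lett k (x : X k) : letter := Tagged (fun k => X k : Type) x.

Definition alternating (s : seq letter) : bool :=
  all (fun t => tagged t \in ts_circ (X (tag t))) s &&
  sorted (fun i j => i != j) (map tag s).

Definition word := {s : seq letter | alternating s}.
HB.instance Definition _ := Choice.on word.

Inductive cfree_rel : {malg C[word]} -> Prop :=
| CfreeLin (u v : seq letter) k (c : C) (x y : X k) (w w1 w2 : word) of
    val w = u ++ lett (c *: x + y) :: v &
    val w1 = u ++ lett x :: v & val w2 = u ++ lett y :: v :
  cfree_rel (<< w >> - c *: << w1 >> - << w2 >>).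

Definition cfree_car := presented cfree_rel.
HB.instance Definition _ := GRing.Lmodule.on cfree_car.

Definition elt (w : word) : cfree_car := gen cfree_rel w.

(** Elementary tensors; [0] on sequences that are not alternating. *)
Definition tens (s : seq letter) : cfree_car := oapp elt 0 (insub s).

Definition multilinear (V : lmodType C) (f : seq letter -> V) : Prop :=
  forall u v k (c : C) (x y : X k),
    x \in ts_circ (X k) -> y \in ts_circ (X k) ->
  f (u ++ lett (c *: x + y) :: v) =
  c *: f (u ++ lett x :: v) + f (u ++ lett y :: v).

Lemma alternating_mid u v k (x y : X k) :
  x \in ts_circ (X k) -> y \in ts_circ (X k) ->
  alternating (u ++ lett x :: v) = alternating (u ++ lett y :: v).
Proof. by move=> hx hy; rewrite /alternating !all_cat /= hx hy !map_cat. Qed.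

Lemma alternating_mem u v k (x : X k) :
  alternating (u ++ lett x :: v) -> x \in ts_circ (X k).
Proof. by case/andP; rewrite all_cat /= => /and3P[]. Qed.

Lemma tensE (w : word) : tens (val w) = elt w.
Proof. by rewrite /tens valK. Qed.

Lemma tens_multilinear : multilinear tens.
Proof.
move=> u v k c x y hx hy; have hxy := ts_circ_lin c hx hy.
have [a|na] := boolP (alternating (u ++ lett x :: v)); last first.
  rewrite /tens !insubN /= ?scaler0 ?addr0 //.
    by rewrite (alternating_mid _ _ hy hx).
  by rewrite (alternating_mid _ _ hxy hx).
have a1 : alternating (u ++ lett (c *: x + y) :: v).
  by rewrite (alternating_mid _ _ hxy hx).
have a2 : alternating (u ++ lett y :: v) by rewrite (alternating_mid _ _ hy hx).
rewrite /tens !insubT /= /elt /gen -linearP /=; apply/pclassP.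
rewrite opprD addrA; apply: lspan_gen.
exact: (@CfreeLin u v k c x y).
Qed.

Lemma multilinear_rel (V : lmodType C) (f : seq letter -> V) :
  multilinear f -> forall m, cfree_rel m -> free_lift (f \o val) m = 0.
Proof.
move=> fl _ [u v k c x y w w1 w2 ew e1 e2].
have hx : x \in ts_circ (X k) by apply: (@alternating_mem u v); rewrite -e1 (valP w1).
have hy : y \in ts_circ (X k) by apply: (@alternating_mem u v); rewrite -e2 (valP w2).
rewrite !linearB linearZ /= !free_lift1 /= ew e1 e2 fl //.
by rewrite -addrA -opprD subrr.
Qed.

Definition cfree_xi : cfree_car := tens [::].
Definition cfree_circ : {pred cfree_car} :=
  fun x => `[< lspan (fun y => exists w : word, val w != [::] /\ y = elt w) x >].
Definition cfree_phi : cfree_car -> C :=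
  plift (V := C^o) (fun w : word => \prod_(t <- val w) ts_phi (X (tag t)) (tagged t)).

Fact cfree_phi_multilinear :
  multilinear (V := C^o) (fun s => \prod_(t <- s) ts_phi (X (tag t)) (tagged t)).
Proof.
move=> u v k c x y hx hy; rewrite !big_cat !big_cons /= linearP /=.
by rewrite [_ *: _]mulrCA -mulrDr [c * (_ * _)]mulrA -mulrDl.
Qed.

Fact cfree_phi_is_linear : scalar cfree_phi.
Proof. exact: (plift_is_linear (multilinear_rel cfree_phi_multilinear)). Qed.
HB.instance Definition _ :=
  GRing.isLinear.Build C cfree_car C *%R cfree_phi cfree_phi_is_linear.

Lemma cfree_phiE (w : word) :
  cfree_phi (elt w) = \prod_(t <- val w) ts_phi (X (tag t)) (tagged t).
Proof. exact: (pliftE (multilinear_rel cfree_phi_multilinear)). Qed.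

Let vac (s : seq letter) : C^o := (s == [::])%:R.

Let vac_multilinear : multilinear vac.
Proof.
move=> u v k c x y hx hy; rewrite /vac.
by case: u => [|? ?] /=; rewrite scaler0 addr0.
Qed.

Let cfree_psi : cfree_car -> C^o := plift (vac \o val).

Let cfree_psi_lin : linear cfree_psi.
Proof. exact: (plift_is_linear (multilinear_rel vac_multilinear)). Qed.

Let cfree_psiE w : cfree_psi (elt w) = vac (val w).
Proof. exact: (pliftE (multilinear_rel vac_multilinear)). Qed.

Let elt_nil (w : word) : val w = [::] -> elt w = cfree_xi.
Proof. by move=> e; rewrite -tensE e. Qed.

Let cfree_psi_xi : cfree_psi cfree_xi = 1.
Proof. by rewrite /cfree_xi /tens insubT /= cfree_psiE /vac eqxx. Qed.

Fact cfree_phi_xi : cfree_phi cfree_xi = 1.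
Proof. by rewrite /cfree_xi /tens insubT /= cfree_phiE big_nil. Qed.

Let cfree_psi_circ x : x \in cfree_circ -> cfree_psi x = 0.
Proof.
have psi0 : cfree_psi 0 = 0.
  by have := cfree_psi_lin (-1) 0 0; rewrite scaler0 addr0 scaleN1r addNr.
move/asboolP; elim=> [//|c u v [w [wn ->]] _ IH].
by rewrite cfree_psi_lin IH addr0 cfree_psiE /vac (negbTE wn) scaler0.
Qed.

Fact cfree_circ_submod : submod_closed cfree_circ.
Proof.
split=> [|c x y /asboolP hx /asboolP hy]; apply/asboolP; first exact: lspan0.
by apply: lspanD => //; apply: lspanZ.
Qed.

Fact cfree_xi_neq0 : cfree_xi != 0.
Proof.
apply/eqP => e; have := cfree_phi_xi; rewrite e linear0 => /eqP.
by rewrite eq_sym oner_eq0.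
Qed.

Fact cfree_direct x : exists! c : C, x - c *: cfree_xi \in cfree_circ.
Proof.
have psi_sub c : x - c *: cfree_xi \in cfree_circ -> cfree_psi x = c.
  move=> /cfree_psi_circ; rewrite addrC -scaleNr cfree_psi_lin cfree_psi_xi.
  by rewrite [_ *: _]mulr1 addrC => /eqP; rewrite subr_eq0 => /eqP.
have [circ0 circL] := cfree_circ_submod.
have [c hc] : exists c : C, x - c *: cfree_xi \in cfree_circ.
  elim: (presented_span x) => [|d _ y [w ->] _ [c hc]].
    by exists 0; rewrite scale0r subr0.
  have [/elt_nil e|wn] := eqVneq (val w) [::].
    by exists (d + c); rewrite -/(elt w) e scalerDl opprD addrACA subrr add0r.
  exists c; rewrite -addrA; apply: circL => //.
  by apply/asboolP; apply: lspan_gen; exists w.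
by exists c; split=> // d hd; rewrite -(psi_sub _ hc) -(psi_sub _ hd).
Qed.

Definition cfree : two_state_space C :=
  @TwoStateSpace C cfree_car cfree_circ cfree_xi cfree_phi
    cfree_circ_submod cfree_xi_neq0 cfree_direct cfree_phi_xi.

(** [Vmap k x s] is the image of [x (x) s] under the identification of the tensor
    product of [X k] and [X(l, k)] with the c-free product, where [s] is a word
    whose first index is not [k]. *)
Definition Vmap k (x : X k) (s : seq letter) : cfree :=
  ts_psi x *: tens s + tens (lett (ts_proj x) :: s).
Definition Wmap k (s : seq letter) (x : X k) : cfree :=
  ts_psi x *: tens s + tens (rcons s (lett (ts_proj x))).

(** [V_k (T (x) I) V_k^-1] on an elementary tensor: [x_1 (x) ... (x) x_n]
    is the image of [x_1 (x) (x_2 (x) ... (x) x_n)] if [x_1] is in [X k], and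
    of [xi_k (x) (x_1 (x) ... (x) x_n)] otherwise. *)
Definition lambda_word k (T : X k -> X k) (s : seq letter) : cfree :=
  if s is t :: s' then
    untag (Vmap (T (ts_xi (X k))) s) (fun x : X k => Vmap (T x) s') t
  else Vmap (T (ts_xi (X k))) s.
Definition rho_word k (T : X k -> X k) (s : seq letter) : cfree :=
  if rev s is t :: s' then
    untag (Wmap s (T (ts_xi (X k)))) (fun x : X k => Wmap (rev s') (T x)) t
  else Wmap s (T (ts_xi (X k))).

Definition lambda k (T : X k -> X k) : cfree -> cfree :=
  plift (lambda_word T \o val).
Definition rho k (T : X k -> X k) : cfree -> cfree :=
  plift (rho_word T \o val).

Lemma Vmap_linear k s : linear (fun x : X k => Vmap x s).
Proof.
move=> c x y; rewrite /Vmap !linearP /=.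
rewrite (tens_multilinear [::]) ?ts_proj_circ //=.
by rewrite scalerDl !scalerA [c * _]mulrC addrACA.
Qed.

Lemma Wmap_linear k s : linear (fun x : X k => Wmap s x).
Proof.
move=> c x y; rewrite /Wmap !linearP /= -!cats1.
rewrite (tens_multilinear _ [::]) ?ts_proj_circ //=.
by rewrite scalerDl !scalerA [c * _]mulrC addrACA.
Qed.

Lemma Vmap_multilinear k (x : X k) : multilinear (Vmap x).
Proof.
move=> u v k' c y z hy hz; rewrite /Vmap tens_multilinear //.
rewrite -cat_cons tens_multilinear //.
by rewrite !scalerDr !scalerA [_ * c]mulrC addrACA.
Qed.

Lemma Wmap_multilinear k (x : X k) : multilinear (fun s => Wmap s x).
Proof.
move=> u v k' c y z hy hz; rewrite /Wmap tens_multilinear //.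
rewrite !rcons_cat !rcons_cons tens_multilinear //.
by rewrite !scalerDr !scalerA [_ * c]mulrC addrACA.
Qed.

Lemma untag_lett (R : Type) (idx : R) k (F : X k -> R) (x : X k) :
  untag idx F (lett x) = F x.
Proof. by rewrite (untagE _ _ (erefl : tag (lett x) = k)). Qed.

Lemma lambda_word_multilinear k (T : {linear X k -> X k}) :
  multilinear (lambda_word T).
Proof.
move=> [|t u] v k' c x y hx hy /=; last first.
  rewrite {1 2 3}/untag; case: eqP => e; first exact: Vmap_multilinear.
  by rewrite -!cat_cons; apply: Vmap_multilinear.
case: (eqVneq k' k) => [e|ne]; last first.
  by rewrite !untag_dflt //; apply: (Vmap_multilinear _ [::]).
by case: _ / e T => T; rewrite !untag_lett linearP Vmap_linear.
Qed.

Lemma rho_word_rcons k (T : X k -> X k) s t :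
  rho_word T (rcons s t) =
  untag (Wmap (rcons s t) (T (ts_xi (X k)))) (fun x : X k => Wmap s (T x)) t.
Proof. by rewrite /rho_word rev_rcons revK. Qed.

Lemma rho_word_multilinear k (T : {linear X k -> X k}) :
  multilinear (rho_word T).
Proof.
move=> u v; case/lastP: v => [|v t] k' c x y hx hy; last first.
  rewrite -!rcons_cons -!rcons_cat !rho_word_rcons.
  rewrite /untag; case: eqP => e; first exact: Wmap_multilinear.
  rewrite !rcons_cat !rcons_cons; exact: Wmap_multilinear.
rewrite !cats1 !rho_word_rcons.
case: (eqVneq k' k) => [e|ne]; last first.
  by rewrite !untag_dflt // -!cats1; apply: Wmap_multilinear.
by case: _ / e T => T; rewrite !untag_lett linearP Wmap_linear.
Qed.

Section Operators.
Variables (k : K) (T : {linear X k -> X k}).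

Fact lambda_is_linear : linear (lambda T).
Proof. exact: (plift_is_linear (multilinear_rel (lambda_word_multilinear T))). Qed.
HB.instance Definition _ :=
  GRing.isLinear.Build C cfree cfree *:%R (lambda T) lambda_is_linear.

Fact rho_is_linear : linear (rho T).
Proof. exact: (plift_is_linear (multilinear_rel (rho_word_multilinear T))). Qed.
HB.instance Definition _ :=
  GRing.isLinear.Build C cfree cfree *:%R (rho T) rho_is_linear.

Lemma lambda_tens (s : seq letter) :
  alternating s -> lambda T (tens s) = lambda_word T s.
Proof.
move=> a; rewrite -[s]/(val (Sub s a : word)) tensE.
exact: (pliftE (multilinear_rel (lambda_word_multilinear T))).
Qed.

Lemma rho_tens (s : seq letter) :
  alternating s -> rho T (tens s) = rho_word T s.
Proof.
move=> a; rewrite -[s]/(val (Sub s a : word)) tensE.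
exact: (pliftE (multilinear_rel (rho_word_multilinear T))).
Qed.

(** The defining property of [lambda]: it intertwines [T (x) I] through [Vmap]. *)
Lemma lambda_V (x : X k) (s : seq letter) :
  alternating s -> (if s is t :: _ then tag t != k else true) ->
  lambda T (Vmap x s) = Vmap (T x) s.
Proof.
move=> a hk.
have a' : alternating (lett (ts_proj x) :: s).
  case/andP: a => a1 a2; rewrite /alternating /= ts_proj_circ a1 /=.
  by case: s {a1} hk a2 => //= t s; rewrite eq_sym => -> ->.
rewrite {1}/Vmap linearP /= !lambda_tens //= untag_lett.
have -> : lambda_word T s = Vmap (T (ts_xi (X k))) s.
  by case: s hk {a a'} => //= t s h; rewrite untag_dflt.
by rewrite -Vmap_linear -linearP -ts_projE.
Qed.

Lemma rho_W (x : X k) (s : seq letter) :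
  alternating s -> (if rev s is t :: _ then tag t != k else true) ->
  rho T (Wmap s x) = Wmap s (T x).
Proof.
move=> a hk.
have a' : alternating (rcons s (lett (ts_proj x))).
  case/andP: a => a1 a2; rewrite /alternating all_rcons /= ts_proj_circ a1 /=.
  case/lastP: s {a1} hk a2 => // s t; rewrite rev_rcons !map_rcons => h.
  by case: s => [|t' s] /=; rewrite ?h //= [in X in _ -> X]rcons_path last_rcons /= h andbT.
rewrite {1}/Wmap linearP /= !rho_tens // rho_word_rcons untag_lett.
have -> : rho_word T s = Wmap s (T (ts_xi (X k))).
  case/lastP: s hk {a a'} => // s t.
  by rewrite rho_word_rcons rev_rcons => h; rewrite untag_dflt.
by rewrite -Wmap_linear -linearP -ts_projE.
Qed.

End Operators.

End CFree.

Variant side := Left | Right.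

Definition bool_of_side (s : side) : bool := if s is Left then true else false.
Definition side_of_bool (b : bool) : side := if b then Left else Right.
Fact bool_of_sideK : cancel bool_of_side side_of_bool.
Proof. by case. Qed.
HB.instance Definition _ := Countable.copy side (can_type bool_of_sideK).
HB.instance Definition _ : isFinite side := CanIsFinite bool_of_sideK.

(** The free product of the unital algebras [S k s], [k : K] and [s : side], as
    a vector space, which is all that functionals on it need: it is spanned by the words in the letters [(k, s, a)] with
    [a] in [S k s]. *)
Section FreeProduct.
Variables (C : fieldType) (A : algType C) (K : choiceType).
Variable S : K -> side -> {pred A}.

Definition fp_letter : Type := (K * side * A)%type.
HB.instance Definition _ := Choice.on fp_letter.
Definition fp_word :=
  {w : seq fp_letter | all (fun t => t.2 \in S t.1.1 t.1.2) w}.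
HB.instance Definition _ := Choice.on fp_word.

Inductive free_prod_rel : {malg C[fp_word]} -> Prop :=
| FPLin (u v : seq fp_letter) i c (a b : A) (w w1 w2 : fp_word) of
    val w = u ++ (i, c *: a + b) :: v &
    val w1 = u ++ (i, a) :: v & val w2 = u ++ (i, b) :: v :
  free_prod_rel (<< w >> - c *: << w1 >> - << w2 >>)
| FPMul (u v : seq fp_letter) i (a b : A) (w w' : fp_word) of
    val w = u ++ (i, a * b) :: v & val w' = u ++ (i, a) :: (i, b) :: v :
  free_prod_rel (<< w >> - << w' >>)
| FPOne (u v : seq fp_letter) i (w w' : fp_word) of
    val w = u ++ (i, 1) :: v & val w' = u ++ v :
  free_prod_rel (<< w >> - << w' >>).

Definition free_prod := presented free_prod_rel.
HB.instance Definition _ := GRing.Lmodule.on free_prod.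

(** The homomorphism to [A] that is the identity on each [S k s], and the one
    to the linear operators on [E] that is [op k s] on [S k s]. *)
Definition tau : free_prod -> A :=
  plift (fun w : fp_word => \prod_(t <- val w) t.2).

Definition op_word (E : Type) (op : K -> side -> A -> E -> E)
    (w : seq fp_letter) : E -> E :=
  foldr (fun t f => op t.1.1 t.1.2 t.2 \o f) id w.

Definition tau_op (E : lmodType C) (op : K -> side -> A -> E -> E) :
    free_prod -> (E -> E) :=
  plift (op_word op \o val).

Lemma tauE (w : fp_word) :
  tau (gen free_prod_rel w) = \prod_(t <- val w) t.2.
Proof.
apply: pliftE => _ [u v i c a b w0 w1 w2 e e1 e2|u v i a b w0 w1 e e1|u v i w0 w1 e e1].
- rewrite !linearB linearZ /= !free_lift1 e e1 e2 !big_cat !big_cons /=.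
  by rewrite mulrDl mulrDr -scalerAl -scalerAr -addrA -opprD subrr.
- rewrite linearB /= !free_lift1 e e1 !big_cat !big_cons /=.
  by rewrite !mulrA subrr.
- by rewrite linearB /= !free_lift1 e e1 !big_cat big_cons /= mul1r subrr.
Qed.

(** [op] restricts to a unital homomorphism from [B] to the algebra of linear
    operators on [E]. *)
Definition unital_hom (E : lmodType C) (B : {pred A})
    (op : A -> {linear E -> E}) : Prop :=
  [/\ forall x, op 1 x = x,
      {in B &, forall a b x, op (a * b) x = op a (op b x)} &
      forall c, {in B &, forall a b x, op (c *: a + b) x = c *: op a x + op b x}].

Lemma tau_opE (E : lmodType C) (op : K -> side -> A -> {linear E -> E})
    (w : fp_word) : (forall k s, unital_hom (S k s) (op k s)) ->
  tau_op op (gen free_prod_rel w) = op_word op (val w).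
Proof.
move=> hop; rewrite /tau_op.
have cat u v x : op_word op (u ++ v) x = op_word op u (op_word op v x).
  by elim: u => //= t u ->.
have lin u : linear (op_word op u).
  by elim: u => [|t u IH] c x y /=; rewrite ?IH ?linearP.
have mem (w0 : fp_word) u t v : val w0 = u ++ t :: v -> t.2 \in S t.1.1 t.1.2.
  by move=> e; have := valP w0; rewrite e all_cat /= => /and3P[].
apply: (@pliftE _ _ _ _ (op_word op \o val)).
move=> _ [u v i c a b w0 w1 w2 e e1 e2|u v i a b w0 w1 e e1|u v i w0 w1 e e1].
- have ha := mem _ _ _ _ e1; have hb := mem _ _ _ _ e2.
  rewrite !linearB linearZ /= !free_lift1 /= e e1 e2; apply/funext => x.
  have [_ _ h] := hop i.1 i.2.
  rewrite -addrA -opprD; apply/eqP; rewrite subr_eq0; apply/eqP.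
  rewrite !cat /= h // lin; congr (_ *: _ + _); exact/esym/cat.
- have ha := mem _ _ _ _ e1; have hb : b \in S i.1 i.2.
    by apply: (mem w1 (rcons u (i, a)) (i, b) v); rewrite e1 cat_rcons.
  rewrite linearB /= !free_lift1 /= e e1; apply/funext => x.
  have [_ h _] := hop i.1 i.2.
  by apply/eqP; rewrite subr_eq0; apply/eqP; rewrite !cat /= h.
- rewrite linearB /= !free_lift1 /= e e1; apply/funext => x.
  have [h _ _] := hop i.1 i.2.
  by apply/eqP; rewrite subr_eq0; apply/eqP; rewrite !cat /= h.
Qed.

Definition pair_distribution (phi psi : A -> C) :
    (free_prod -> C) * (free_prod -> C) :=
  (phi \o tau, psi \o tau).

Definition op_pair_distribution (E : two_state_space C)
    (op : K -> side -> A -> {linear E -> E}) : (free_prod -> C) * (free_prod -> C) :=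
  (fun z => ts_phi E (tau_op op z (ts_xi E)),
   fun z => ts_psi (tau_op op z (ts_xi E))).

Definition lambda_rho (X : K -> two_state_space C)
    (lr : forall k, side -> A -> {linear X k -> X k}) (k : K) (s : side) (a : A) :
    {linear cfree X -> cfree X} :=
  match s with
  | Left => lambda (lr k Left a)
  | Right => rho (lr k Right a)
  end.

Definition c_bi_free (phi psi : A -> C) : Prop :=
  exists (X : K -> two_state_space C)
         (lr : forall k, side -> A -> {linear X k -> X k}),
    (forall k s, unital_hom (S k s) (lr k s)) /\
    pair_distribution phi psi = op_pair_distribution (lambda_rho lr).

End FreeProduct.

Section BNC.
Variables (n : nat) (chi : 'I_n -> side).

(** The total order listing the left indices increasingly, then the right
    indices decreasingly. *)
Definition chi_lt (i j : 'I_n) : bool :=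
  match chi i, chi j with
  | Left, Left => (i < j)%N
  | Left, Right => true
  | Right, Left => false
  | Right, Right => (j < i)%N
  end.

Definition noncrossing (pi : {set {set 'I_n}}) : bool :=
  [forall V in pi, forall U in pi, (V != U) ==>
    [forall i in V, forall j in U, forall k in V, forall l in U,
      ~~ [&& chi_lt i j, chi_lt j k & chi_lt k l]]].

Definition BNC : {set {set {set 'I_n}}} :=
  [set pi | partition pi [set: 'I_n] && noncrossing pi].

Definition chi_min (V : {set 'I_n}) (i : 'I_n) : bool :=
  (i \in V) && [forall j in V, (j != i) ==> chi_lt i j].
Definition chi_max (V : {set 'I_n}) (i : 'I_n) : bool :=
  (i \in V) && [forall j in V, (j != i) ==> chi_lt j i].

Definition interior_block (pi : {set {set 'I_n}}) (V : {set 'I_n}) : bool :=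
  [exists U in pi, (U != V) &&
    ([exists i, exists j, [&& chi_min U i, chi_min V j & chi_lt i j]] &&
     [exists i, exists j, [&& chi_max V i, chi_max U j & chi_lt i j]])].

End BNC.

(** Restriction to [V], relabelled increasingly by ['I_#|V|]. *)
Definition restrict (T : Type) n (V : {set 'I_n}) (f : 'I_n -> T) :
    'I_#|V| -> T :=
  fun i => f (enum_val i).
Arguments restrict {T n} V f _.

Section Cumulants.
Variables (C : fieldType) (A : algType C).

Definition multi_functional := forall n, ('I_n -> side) -> ('I_n -> A) -> C.

Definition moment (f : A -> C) n (a : 'I_n -> A) : C := f (\prod_(i < n) a i).

Definition kappa_term (kappa : multi_functional) n chi (a : 'I_n -> A)
    (pi : {set {set 'I_n}}) : C :=
  \prod_(V in pi) kappa #|V| (restrict V chi) (restrict V a).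

Definition ckappa_term (kappa ckappa : multi_functional) n chi (a : 'I_n -> A)
    (pi : {set {set 'I_n}}) : C :=
  (\prod_(V in pi | interior_block chi pi V)
     kappa #|V| (restrict V chi) (restrict V a)) *
  (\prod_(V in pi | ~~ interior_block chi pi V)
     ckappa #|V| (restrict V chi) (restrict V a)).

Definition moment_cumulant (psi : A -> C) (kappa : multi_functional) : Prop :=
  forall n, (0 < n)%N -> forall (chi : 'I_n -> side) (a : 'I_n -> A),
    moment psi a = \sum_(pi in BNC chi) kappa_term kappa chi a pi.

Definition c_moment_cumulant (phi : A -> C) (kappa ckappa : multi_functional) :
    Prop :=
  forall n, (0 < n)%N -> forall (chi : 'I_n -> side) (a : 'I_n -> A),
    moment phi a = \sum_(pi in BNC chi) ckappa_term kappa ckappa chi a pi.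

(** Both formulas have the form [moment f a = \sum_pi term F chi a pi] with
    unknown [F], where the one-block partition contributes [F n chi a] and the
    other ones involve [F] in lower orders only.  This defines [F] by recursion
    on [n]; the fuel [m] is an upper bound for [n].  See the lemmas
    [kappa_moment_cumulant], [kappa_uniq], [kappa_multilinear] below and their
    analogues for [ckappa]. *)
Fixpoint cumulant_rec (f : A -> C)
    (term : multi_functional ->
            forall n, ('I_n -> side) -> ('I_n -> A) -> {set {set 'I_n}} -> C)
    (m : nat) : multi_functional := fun n chi a =>
  if m is m'.+1 then
    moment f a - \sum_(pi in BNC chi | pi != [set [set: 'I_n]])
                   term (cumulant_rec f term m') n chi a pi
  else 0.

Arguments cumulant_rec f term m n chi a : clear implicits.

Definition kappa (psi : A -> C) : multi_functional :=
  fun n => cumulant_rec psi kappa_term n n.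
Arguments kappa psi n chi a : clear implicits.

Definition ckappa (phi psi : A -> C) : multi_functional :=
  fun n => cumulant_rec phi (ckappa_term (kappa psi)) n n.
Arguments ckappa phi psi n chi a : clear implicits.

Lemma one_block_BNC n (chi : 'I_n -> side) :
  (0 < n)%N -> [set [set: 'I_n]] \in BNC chi.
Proof.
move=> n0; rewrite inE; apply/andP; split.
  apply/and3P; split; first by rewrite /cover big_set1.
    by apply/trivIsetP => V U /set1P -> /set1P ->; rewrite eqxx.
  rewrite inE eq_sym; apply/set0Pn; exists (Ordinal n0); exact: in_setT.
apply/forall_inP => V /set1P ->; apply/forall_inP => U /set1P ->.
by rewrite eqxx.
Qed.

Lemma block_gt0 n (chi : 'I_n -> side) pi V :
  pi \in BNC chi -> V \in pi -> (0 < #|V|)%N.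
Proof.
rewrite inE => /andP[/and3P[_ _ h] _] Vpi; rewrite card_gt0.
by apply: contraNneq h => <-.
Qed.

Lemma block_ltn n (chi : 'I_n -> side) pi V :
  pi \in BNC chi -> pi != [set [set: 'I_n]] -> V \in pi -> (#|V| < n)%N.
Proof.
rewrite inE => /andP[/and3P[_ tr h0] _] ne Vpi.
rewrite ltnNge; apply/negP => le.
have VT : V = [set: 'I_n].
  by apply/eqP; rewrite eqEcard subsetT cardsT card_ord.
case/negP: ne; apply/eqP/setP => U; rewrite inE; apply/idP/eqP => [Upi|->]; last first.
  by rewrite -VT.
apply/eqP; apply/negPn/negP => UV; move/trivIsetP: tr => /(_ _ _ Upi Vpi).
rewrite VT => /(_ UV); rewrite -setI_eq0 setIT => /eqP U0.
by case/negP: h0; rewrite -U0.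
Qed.

Lemma one_block_restrict (F : multi_functional) n chi (a : 'I_n -> A) :
  F #|[set: 'I_n]| (restrict [set: 'I_n] chi) (restrict [set: 'I_n] a) = F n chi a.
Proof.
have gen m (e : m = n) (f : 'I_m -> 'I_n) : (forall i, f i = i :> nat) ->
    F m (fun i => chi (f i)) (fun i => a (f i)) = F n chi a.
  case: _ / e chi a f => chi a f hf.
  have -> : f = id by apply/funext => i; apply/val_inj/hf.
  by [].
apply: gen => [|i]; first by rewrite cardsT card_ord.
have cn : #|[set: 'I_n]| = n by rewrite cardsT card_ord.
have ltn_i : (i < n)%N by rewrite -[X in (_ < X)%N]cn.
rewrite /enum_val enum_setT -enumT.
by rewrite nth_enum_ord.
Qed.

Lemma one_block_exterior n (chi : 'I_n -> side) :
  ~~ interior_block chi [set [set: 'I_n]] [set: 'I_n].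
Proof.
by apply/negP => /exists_inP[U /set1P ->]; rewrite eqxx.
Qed.

(** [upd a i x] is [a] with the [i]-th entry replaced by [x]. *)
Definition upd n (a : 'I_n -> A) (i : 'I_n) (x : A) : 'I_n -> A :=
  fun j => if j == i then x else a j.

Definition multilinear_at (F : multi_functional) n : Prop :=
  forall chi a i c x y,
  F n chi (upd a i (c *: x + y)) = c * F n chi (upd a i x) + F n chi (upd a i y).

Section Recursion.
Variables (f : A -> C)
  (term : multi_functional ->
            forall n, ('I_n -> side) -> ('I_n -> A) -> {set {set 'I_n}} -> C).
Hypothesis term_local : forall (F G : multi_functional) n chi (a : 'I_n -> A)
    (pi : {set {set 'I_n}}),
  (forall V, V \in pi -> F #|V| =2 G #|V|) -> term F chi a pi = term G chi a pi.
Hypothesis term_one : forall (F : multi_functional) n chi (a : 'I_n -> A),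
  term F chi a [set [set: 'I_n]] = F n chi a.

Let F := fun n => cumulant_rec f term n n.

Let recE m1 m2 n : (0 < n)%N -> (n <= m1)%N -> (n <= m2)%N ->
  cumulant_rec f term m1 n =2 cumulant_rec f term m2 n.
Proof.
elim: m1 m2 n => [|m1 IH] [|m2] n n0 h1 h2 chi a //=; try by case: n n0 h1 h2 chi a.
congr (_ - _); apply: eq_bigr => pi /andP[hpi ne].
apply: term_local => V Vpi; have lt := block_ltn hpi ne Vpi.
by apply: IH; rewrite ?(block_gt0 hpi) // -ltnS; apply: leq_trans lt _.
Qed.

Let FE n chi (a : 'I_n -> A) : (0 < n)%N ->
  @F n chi a = moment f a - \sum_(pi in BNC chi | pi != [set [set: 'I_n]]) term (@F) chi a pi.
Proof.
case: n chi a => // n chi a _ /=; rewrite {1}/F /=; congr (_ - _).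
apply: eq_bigr => pi /andP[hpi ne].
apply: term_local => V Vpi; have lt := block_ltn hpi ne Vpi.
by apply: recE; rewrite ?(block_gt0 hpi).
Qed.

Lemma cumulant_recP n chi (a : 'I_n -> A) : (0 < n)%N ->
  moment f a = \sum_(pi in BNC chi) term (@F) chi a pi.
Proof.
move=> n0; rewrite (bigD1 _ (one_block_BNC chi n0)) /= term_one FE //.
by rewrite subrK.
Qed.

Lemma cumulant_rec_uniq (G : multi_functional) :
  (forall n chi (a : 'I_n -> A), (0 < n)%N ->
     moment f a = \sum_(pi in BNC chi) term G chi a pi) ->
  forall n, (0 < n)%N -> G n =2 @F n.
Proof.
move=> hG n; elim/ltn_ind: n => n IH n0 chi a.
rewrite FE // (hG _ chi a n0) (bigD1 _ (one_block_BNC chi n0)) /= term_one.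
apply/eqP; rewrite eq_sym subr_eq addrC; apply/eqP; rewrite addrC; congr (_ + _).
apply: eq_bigr => pi /andP[hpi ne].
apply: term_local => V Vpi.
by apply: IH; rewrite ?(block_gt0 hpi) ?(block_ltn hpi).
Qed.

Hypothesis f_linear : scalar f.
Hypothesis term_multilinear : forall G n chi (pi : {set {set 'I_n}}),
  partition pi [set: 'I_n] -> (forall V, V \in pi -> multilinear_at G #|V|) ->
  forall a i c x y, term G chi (upd a i (c *: x + y)) pi =
    c * term G chi (upd a i x) pi + term G chi (upd a i y) pi.

Let prod_upd n (a : 'I_n -> A) i : exists u v, forall x,
  \prod_(j < n) upd a i x j = u * x * v.
Proof.
elim: n a i => [|n IH] a i; first by case: i.
have [j ->|->] := unliftP ord0 i.
  have [u [v h]] := IH (fun j => a (lift ord0 j)) j.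
  exists (a ord0 * u), v => x; rewrite big_ord_recl {1}/upd (negbTE (neq_lift _ _)).
  rewrite -!mulrA; congr (_ * _); rewrite mulrA -h; apply: eq_bigr => l _.
  by rewrite /upd (inj_eq lift_inj).
exists 1, (\prod_(j < n) a (lift ord0 j)) => x.
by rewrite mul1r big_ord_recl {1}/upd eqxx.
Qed.

Lemma cumulant_rec_multilinear n : (0 < n)%N -> multilinear_at (@F) n.
Proof.
elim/ltn_ind: n => n IH n0 chi a i c x y; rewrite !FE //.
have -> : moment f (upd a i (c *: x + y)) =
          c * moment f (upd a i x) + moment f (upd a i y).
  have [u [v h]] := prod_upd a i.
  by rewrite /moment !h mulrDr mulrDl -scalerAr -scalerAl f_linear.
rewrite mulrBr addrACA -opprD; congr (_ - _).
rewrite mulr_sumr -big_split /=; apply: eq_bigr => pi /andP[hpi ne].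
apply: term_multilinear; first by move: hpi; rewrite inE => /andP[].
by move=> V Vpi; apply: IH; rewrite ?(block_gt0 hpi) ?(block_ltn hpi).
Qed.

End Recursion.

Lemma restrict_upd n (V : {set 'I_n}) i : i \in V ->
  exists j, forall a x, restrict V (upd a i x) = upd (restrict V a) j x.
Proof.
move=> iV; exists (enum_rank_in iV i) => a x; apply/funext => l.
rewrite /restrict /upd -{1}(enum_rankK_in iV iV) (inj_eq enum_val_inj).
by [].
Qed.

Lemma restrict_upd_out n (V : {set 'I_n}) i a x : i \notin V ->
  restrict V (upd a i x) = restrict V a.
Proof.
move=> iV; apply/funext => l; rewrite /restrict /upd.
by case: eqP => // e; rewrite -e enum_valP in iV.
Qed.

Lemma block_prod_multilinear n (H : {set 'I_n} -> multi_functional)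
    (chi : 'I_n -> side) pi :
  partition pi [set: 'I_n] -> (forall V, V \in pi -> multilinear_at (H V) #|V|) ->
  forall a i c x y,
  let P b := \prod_(V in pi) H V #|V| (restrict V chi) (restrict V b) in
  P (upd a i (c *: x + y)) = c * P (upd a i x) + P (upd a i y).
Proof.
move=> hpi hH a i c x y P; pose U := pblock pi i.
have cov : i \in cover pi by case/and3P: hpi => /eqP -> _ _; rewrite in_setT.
have Upi : U \in pi by apply: pblock_mem.
have iU : i \in U by rewrite mem_pblock.
have tr : trivIset pi by case/and3P: hpi.
have PE z : P (upd a i z) = H U #|U| (restrict U chi) (restrict U (upd a i z)) *
    \prod_(V in pi | V != U) H V #|V| (restrict V chi) (restrict V a).
  rewrite /P (bigD1 _ Upi) /=; congr (_ * _); apply: eq_bigr => V /andP[Vpi VU].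
  rewrite restrict_upd_out //; apply: contraNN VU => iV.
  by rewrite /U (def_pblock tr Vpi iV).
rewrite !PE; have [j hj] := restrict_upd iU; rewrite !hj hH //.
by rewrite mulrDl mulrA.
Qed.

Lemma kappa_moment_cumulant psi : moment_cumulant psi (kappa psi).
Proof.
move=> n n0 chi a; apply: cumulant_recP n0 => // [F G m chi' a' pi h|F m chi' a'].
  by apply: eq_bigr => V Vpi; rewrite h.
by rewrite /kappa_term big_set1 one_block_restrict.
Qed.

Lemma kappa_uniq psi (k : multi_functional) :
  moment_cumulant psi k -> forall n, (0 < n)%N -> k n =2 kappa psi n.
Proof.
move=> hk; apply: cumulant_rec_uniq => [F G m chi' a' pi h|F m chi' a'|m chi' a' m0].
- by apply: eq_bigr => V Vpi; rewrite h.
- by rewrite /kappa_term big_set1 one_block_restrict.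
- exact: hk.
Qed.

Lemma kappa_multilinear psi n : scalar psi -> (0 < n)%N ->
  multilinear_at (kappa psi) n.
Proof.
move=> lpsi n0; apply: cumulant_rec_multilinear n0 => //.
- by move=> F G m chi' a' pi h; apply: eq_bigr => V Vpi; rewrite h.
- move=> G m chi pi hpi hG a i c x y.
  exact: (block_prod_multilinear (H := fun _ => G)).
Qed.

Lemma ckappa_term_one (G F : multi_functional) n chi (a : 'I_n -> A) :
  ckappa_term G F chi a [set [set: 'I_n]] = F n chi a.
Proof.
rewrite /ckappa_term big1 => [|V /andP[/set1P ->]]; last by rewrite (negbTE (one_block_exterior _)).
rewrite mul1r (bigD1 [set: 'I_n]) ?set11 ?one_block_exterior //= big1 ?mulr1 ?one_block_restrict //.
by move=> V /andP[/andP[/set1P ->]]; rewrite eqxx.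
Qed.

Lemma ckappa_moment_cumulant phi psi :
  c_moment_cumulant phi (kappa psi) (ckappa phi psi).
Proof.
move=> n n0 chi a; apply: cumulant_recP n0 => // [F G m chi' a' pi h|F m chi' a'].
  by congr (_ * _); apply: eq_bigr => V /andP[Vpi _]; rewrite h.
exact: ckappa_term_one.
Qed.

Lemma ckappa_uniq phi psi (k : multi_functional) :
  c_moment_cumulant phi (kappa psi) k ->
  forall n, (0 < n)%N -> k n =2 ckappa phi psi n.
Proof.
move=> hk; apply: cumulant_rec_uniq => [F G m chi' a' pi h|F m chi' a'|m chi' a' m0].
- by congr (_ * _); apply: eq_bigr => V /andP[Vpi _]; rewrite h.
- exact: ckappa_term_one.
- exact: hk.
Qed.

Lemma ckappa_multilinear phi psi n : scalar phi -> scalar psi -> (0 < n)%N ->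
  multilinear_at (ckappa phi psi) n.
Proof.
move=> lphi lpsi n0; apply: cumulant_rec_multilinear n0 => //.
- move=> F G m chi' a' pi h.
  by congr (_ * _); apply: eq_bigr => V /andP[Vpi _]; rewrite h.
- move=> G m chi pi hpi hG a i c x y.
  have E b : ckappa_term (kappa psi) G chi b pi = \prod_(V in pi)
      (if interior_block chi pi V then kappa psi else G) #|V|
        (restrict V chi) (restrict V b).
    by rewrite /ckappa_term -big_if; apply: eq_bigr => V _; case: ifP.
  rewrite !E; apply: (block_prod_multilinear
    (H := fun V => if interior_block chi pi V then kappa psi else G)) => // V Vpi.
  case: ifP => _; last exact: hG.
  apply: kappa_multilinear => //; rewrite card_gt0.
  by case/and3P: hpi => _ _; apply: contraNneq => <-.
Qed.

End Cumulants.

Arguments kappa {C A} psi n chi a.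
Arguments ckappa {C A} phi psi n chi a.
Arguments cumulant_rec {C A} f term m n chi a.

Definition comb_c_bi_free (C : fieldType) (A : algType C) (K : choiceType)
    (S : K -> side -> {pred A}) (phi psi : A -> C) : Prop :=
  forall n, (2 <= n)%N ->
  forall (chi : 'I_n -> side) (omega : 'I_n -> K) (a : 'I_n -> A),
    (forall i, a i \in S (omega i) (chi i)) ->
    ~ (exists k, forall i, omega i = k) ->
    kappa psi n chi a = 0 /\ ckappa phi psi n chi a = 0.

(* Main.v *)
(** Let [F] be the free algebra on finite words of letters ("blocks").  A left
    letter [a] acts on [F] by opening a block [a] or by putting [a] in front of
    the first open block, if it has the same colour; in both cases the new block
    is either kept open or closed, and a closed block contributes its cumulant
    [kappa].  Right letters act on the last block.  Applying a word of operators
    to [1], the noncrossing partitions with blocks of a single colour appear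
    one by one: the interior blocks are closed, and an exterior block [B]
    contributes the factor [kappa B + B].  Hence the coefficient of [1] is the
    sum of the products of the [kappa B], and the character [B |-> K B - kappa B]
    gives the sum with [K] at the exterior blocks.

    The c-free product has the same moments as [F]: if vectors of the spaces
    [X k] and of [F] are produced from the state-vectors by the same one-coloured
    words, their elementary tensors correspond to products in [F], and this
    correspondence commutes with [lambda], [rho].  So in a c-free product each
    moment is the sum over the partitions with one-coloured blocks.  Comparison
    with the moment-cumulant formulas gives the vanishing of mixed cumulants by
    induction on the order.  Conversely, [A] acting on itself by left
    multiplication has the right marginals, and if the mixed cumulants vanish then
    its c-free powers have the joint distribution of the given family. *)

Require Import Defs.
From HB Require Import structures.
From mathcomp Require Import all_boot all_order all_algebra.
From mathcomp Require Import boolp functions reals complex.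
From mathcomp Require Import finmap monalg.

Set Implicit Arguments.
Unset Strict Implicit.
Unset Printing Implicit Defensive.

Import GRing.Theory.
Local Open Scope ring_scope.

(** * Full Fock space over blocks of letters *)

(** Monomials under concatenation, so that [{malg C[blocks L]}] is the free algebra whose generators
    are the words in [L]. *)
Definition blocks (L : Type) : Type := seq (seq L).
HB.instance Definition _ (L : choiceType) := Choice.on (blocks L).

Fact blocks_unit (L : choiceType) (s t : blocks L) :
  s ++ t = [::] -> s = [::] /\ t = [::].
Proof. by case: s t => [|? ?] []. Qed.
HB.instance Definition _ (L : choiceType) :=
  Choice_isMonomialDef.Build (blocks L) (@catA _) (@cat0s _) (@cats0 _)
    (@blocks_unit L).

(** * Linear extension and scalars in monoid algebras *)

Section FreeModule.
Variables (C : fieldType) (W : choiceType).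
Local Notation M := {malg C[W]}.

Lemma malg_ext (V : lmodType C) (f g : M -> V) :
  linear f -> linear g -> (forall w, f << w >> = g << w >>) -> f =1 g.
Proof.
move=> lf lg fg x.
pose f' : {linear M -> V} := HB.pack f (GRing.isLinear.Build _ _ _ _ f lf).
pose g' : {linear M -> V} := HB.pack g (GRing.isLinear.Build _ _ _ _ g lg).
rewrite -[f]/(f' : _ -> _) -[g]/(g' : _ -> _) (monalgE x) !linear_sum.
apply: eq_bigr => w _.
have -> : << x@_w *g w >> = x@_w *: << w >>.
  by apply/malgP => k; rewrite mcoeffZ !mcoeffU mulr_natr.
by rewrite !linearZ /= fg.
Qed.

End FreeModule.

Section MonoidAlgebra.
Variables (C : fieldType) (W : monomType).
Local Notation M := {malg C[W]}.

Lemma malg_mulU (v w : W) : << v >> * << w >> = << mmul v w >> :> M.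
Proof. by rewrite malgM_def fgmulUU mulr1. Qed.

(** Scalars are multiples of the unit monomial, which is central; by linearity this is checked on
    monomials. *)
Lemma malg_scalerAr (c : C) (x y : M) : c *: (x * y) = x * (c *: y).
Proof.
suff h : x * c%:MP = c%:MP * x by rewrite -!mul_malgC !mulrA h.
apply: (malg_ext (f := fun x => x * c%:MP) (g := fun x => c%:MP * x)) => [d u v|d u v|w].
- by rewrite mulrDl -scalerAl.
- by rewrite !mul_malgC scalerDr !scalerA [c * d]mulrC.
- by rewrite /malgC !malgM_def !fgmulUU mulr1 mul1r mul1m mulm1.
Qed.

End MonoidAlgebra.

(** * Left and right operators on the free algebra of blocks *)

Section FockSpace.
Variables (C : fieldType) (K : eqType) (L : choiceType).
Variables (col : L -> K) (kap : seq L -> C).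
Local Notation F := {malg C[blocks L]}.

Definition blist (s : seq (seq L)) : F := << (s : blocks L) >>.

Lemma blist_nil : blist [::] = 1. Proof. by []. Qed.

Lemma blist_cat s t : blist (s ++ t) = blist s * blist t.
Proof. by rewrite /blist malg_mulU. Qed.

(** A block is either closed, and contributes its cumulant [kap B], or left
    open, to be extended by the operators applied later. *)
Definition eps (B : seq L) : F := kap B *: 1 + blist [:: B].

(** Inspecting the first letter suffices: a block is only ever extended by letters of its own
    colour. The empty block has no colour. *)
Definition hascol (k : K) (B : seq L) : bool :=
  if B is b :: _ then col b == k else false.

(** Only the outermost open block can be extended; extending an inner one would
    produce a crossing with the blocks that remain open around it. *)
Definition join_word (a : L) (s : blocks L) : F :=
  if s is B :: s' then
    if hascol (col a) B then eps (a :: B) * blist s' else 0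
  else 0.
Definition join (a : L) : F -> F := free_lift (join_word a).
HB.instance Definition _ a := GRing.Linear.on (join a).

Definition act_l (a : L) (y : F) : F := eps [:: a] * y + join a y.

(** Reverses the order of the blocks but not the letters inside a block: left and right letters
    alike are put in front of the block they join, so that its letters stay in the order of the
    product. *)
Definition flip : F -> F := free_lift (fun s : blocks L => blist (rev s)).
HB.instance Definition _ := GRing.Linear.on flip.

Definition act_r (a : L) (y : F) : F := flip (act_l a (flip y)).

Fact act_l_is_linear a : linear (act_l a).
Proof.
by move=> c x y; rewrite /act_l mulrDr -malg_scalerAr linearP scalerDr addrACA.
Qed.
HB.instance Definition _ a := GRing.isLinear.Build C F F *:%R (act_l a) (act_l_is_linear a).

Fact act_r_is_linear a : linear (act_r a).
Proof. by move=> c x y; rewrite /act_r !linearP. Qed.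
HB.instance Definition _ a := GRing.isLinear.Build C F F *:%R (act_r a) (act_r_is_linear a).

Definition vac (y : F) : C := y@_([::] : blocks L).

Lemma vac_linear : scalar vac.
Proof. by move=> c x y; rewrite /vac mcoeffD mcoeffZ. Qed.
HB.instance Definition _ := GRing.isLinear.Build C F C *%R vac vac_linear.

Lemma vac_blist s : vac (blist s) = (s == [::])%:R.
Proof. by rewrite /vac mcoeffU1. Qed.

Lemma flip_blist s : flip (blist s) = blist (rev s).
Proof. exact: free_lift1. Qed.

Lemma join_blist a s : join a (blist s) = join_word a s.
Proof. exact: free_lift1. Qed.

Lemma flipK : involutive flip.
Proof.
apply: (malg_ext (f := fun x => flip (flip x)) (g := id)) => [c u v|//|s].
  by rewrite !linearP.
by rewrite -[<< s >>]/(blist s) !flip_blist revK.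
Qed.

Lemma flipM x y : flip (x * y) = flip y * flip x.
Proof.
apply: (malg_ext (f := fun x => flip (x * y)) (g := fun x => flip y * flip x)) => [c u v|c u v|s].
- by rewrite mulrDl -scalerAl linearP.
- by rewrite linearP mulrDr -malg_scalerAr.
apply: (malg_ext (f := fun y => flip (<< s >> * y)) (g := fun y => flip y * flip << s >>)) => [c u v|c u v|t].
- by rewrite mulrDr -malg_scalerAr linearP.
- by rewrite linearP mulrDl -scalerAl.
by rewrite -!/(blist _) -blist_cat !flip_blist rev_cat blist_cat.
Qed.

Lemma flip_eps B : flip (eps B) = eps B.
Proof. by rewrite /eps linearP /= -blist_nil !flip_blist. Qed.

Lemma vac_flip x : vac (flip x) = vac x.
Proof.
apply: (malg_ext (V := C^o) (f := fun x => vac (flip x)) (g := vac)) => [c u v|c u v|s].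
- by rewrite !linearP.
- by rewrite linearP.
by rewrite -/(blist _) flip_blist !vac_blist; case: s => // B s; rewrite rev_cons; case: (rev s).
Qed.

(** On a basis word [join a] sees only the first block, which belongs to the left factor unless that
    factor is the empty word; the latter case has weight [vac x]. *)
Lemma joinM a x y : join a (x * y) = join a x * y + vac x *: join a y.
Proof.
apply: (malg_ext (f := fun x => join a (x * y))
  (g := fun x => join a x * y + vac x *: join a y)) => [c u v|c u v|s].
- by rewrite mulrDl -scalerAl linearP.
- by rewrite !linearP /= mulrDl -scalerAl scalerDl scalerDr scalerA addrACA.
apply: (malg_ext (f := fun y => join a (<< s >> * y))
  (g := fun y => join a << s >> * y + vac << s >> *: join a y)) => [c u v|c u v|t].
- by rewrite mulrDr -malg_scalerAr linearP.
- rewrite mulrDr linearP -malg_scalerAr scalerDr scalerDr !scalerA.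
  by rewrite [c * _]mulrC addrACA.
rewrite -!/(blist _) -blist_cat !join_blist vac_blist.
case: s => [|B s] /=; first by rewrite mul0r add0r scale1r.
rewrite scale0r addr0; case: ifP => _; last by rewrite mul0r.
by rewrite blist_cat mulrA.
Qed.

Lemma join1 a : join a 1 = 0.
Proof. by rewrite -blist_nil join_blist. Qed.

Lemma act_l1 a : act_l a 1 = eps [:: a].
Proof. by rewrite /act_l join1 mulr1 addr0. Qed.

Lemma vac_eps B : vac (eps B) = kap B.
Proof.
rewrite /eps linearP /= -[in vac _]blist_nil !vac_blist eqxx addr0.
exact: mulr1.
Qed.

Lemma join_eps a B :
  join a (eps B) = if hascol (col a) B then eps (a :: B) else 0.
Proof.
rewrite /eps linearP /= join1 scaler0 add0r join_blist /=.
by case: ifP; rewrite ?blist_nil ?mulr1.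
Qed.

(** The two terms of [eps B]: once [B] is closed, the letter passes on to [u]; while [B] is open,
    the letter can only extend it. *)
Lemma join_epsM a B u : join a (eps B * u) =
  kap B *: join a u + (if hascol (col a) B then eps (a :: B) * u else 0).
Proof.
rewrite joinM vac_eps join_eps addrC; congr (_ + _).
by case: ifP; rewrite ?mul0r.
Qed.

(** A centred left factor hides [y] from left operators, just as [lambda] touches only the first
    factor of an elementary tensor whose colour it shares. *)
Lemma act_l_mul a x y : vac x = 0 -> act_l a (x * y) = act_l a x * y.
Proof. by move=> v; rewrite /act_l joinM v scale0r addr0 [RHS]mulrDl mulrA. Qed.

Lemma act_r_mul a x y : vac x = 0 -> act_r a (y * x) = y * act_r a x.
Proof.
by move=> v; rewrite /act_r flipM act_l_mul ?vac_flip // flipM flipK.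
Qed.

Lemma act_r1 a : act_r a 1 = eps [:: a].
Proof. by rewrite /act_r -blist_nil flip_blist act_l1 flip_eps. Qed.

Definition monochromatic (k : K) (y : F) : Prop :=
  lspan (fun z => exists2 s, all (hascol k) s & z = blist s) y.

Lemma monochromatic_blist k s : all (hascol k) s -> monochromatic k (blist s).
Proof. by move=> h; apply: lspan_gen; exists s. Qed.

Lemma monochromatic_flip k y : monochromatic k y -> monochromatic k (flip y).
Proof.
elim=> [|c x z [s hs ->] _ IH]; first by rewrite linear0; exact: lspan0.
rewrite linearP /= flip_blist; apply: lspanP IH; exists (rev s) => //.
by rewrite all_rev.
Qed.

Lemma monochromatic_eps k B s : hascol k B -> all (hascol k) s ->
  monochromatic k (eps B * blist s).
Proof.
move=> hB hs; rewrite /eps mulrDl -scalerAl mul1r -blist_cat.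
apply: lspanD; first by apply: lspanZ; apply: monochromatic_blist.
by apply: monochromatic_blist; rewrite /= hB.
Qed.

Lemma monochromatic_act_l a y :
  monochromatic (col a) y -> monochromatic (col a) (act_l a y).
Proof.
elim=> [|c x z [s hs ->] _ IH]; first by rewrite linear0; exact: lspan0.
rewrite linearP; apply: lspanD IH; apply: lspanZ; apply: lspanD.
  by apply: monochromatic_eps; rewrite /= ?eqxx.
rewrite join_blist; case: s hs => [|B s] /=; first by move=> _; exact: lspan0.
by case/andP => -> hs; apply: monochromatic_eps; rewrite /= ?eqxx.
Qed.

Lemma monochromatic_act_r a y :
  monochromatic (col a) y -> monochromatic (col a) (act_r a y).
Proof. by move=> /monochromatic_flip/monochromatic_act_l/monochromatic_flip. Qed.

(** Every open block has colour [k], and the empty word has no block, so nothing can be joined and a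
    new block must be opened. *)
Lemma act_l_other k a y : monochromatic k y -> col a != k ->
  act_l a y = eps [:: a] * y.
Proof.
move=> my ne; rewrite /act_l; suff -> : join a y = 0 by rewrite addr0.
elim: my => [|c x z [s hs ->] _ IH]; first by rewrite linear0.
rewrite linearP /= IH addr0 join_blist; case: s hs => [|[|b B] s] /=; rewrite ?scaler0 //.
by case/andP => /eqP ->; rewrite eq_sym (negbTE ne) scaler0.
Qed.

Lemma act_r_other k a y : monochromatic k y -> col a != k ->
  act_r a y = y * eps [:: a].
Proof.
move=> /monochromatic_flip my ne.
by rewrite /act_r (act_l_other my) // flipM flipK flip_eps.
Qed.

(** * Characters of the free algebra of blocks *)

Section Evaluation.
Variable th : seq L -> C.

Definition theta_word (s : blocks L) : C := \prod_(B <- s) th B.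

Fact theta_word_mmorphism : mmorphism theta_word.
Proof.
by split=> [s t|]; rewrite /theta_word ?big_nil // big_cat.
Qed.
HB.instance Definition _ :=
  isMultiplicative.Build (blocks L) C theta_word theta_word_mmorphism.

(** With [th] the difference of the two kinds of cumulants, [theta] takes
    [eps kap B] to the c-cumulant of [B]; with [th = 0] it is [vac]. *)
Definition theta : F -> C := mmap idfun theta_word.
HB.instance Definition _ := GRing.RMorphism.on theta.
HB.instance Definition _ := GRing.Linear.on theta.

Lemma theta_blist s : theta (blist s) = \prod_(B <- s) th B.
Proof. by rewrite /theta mmapU mul1r. Qed.

Lemma theta_eps B : theta (eps B) = kap B + th B.
Proof. by rewrite /eps linearP /= rmorph1 theta_blist big_seq1 mulr1. Qed.

End Evaluation.

Lemma theta0 y : theta (fun=> 0) y = vac y.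
Proof.
apply: (malg_ext (V := C^o) (f := theta (fun=> 0)) (g := vac)) => [c u v|c u v|s].
- by rewrite linearP.
- by rewrite linearP.
rewrite -/(blist s) theta_blist vac_blist; case: s => [|B s]; first by rewrite big_nil.
by rewrite big_cons mul0r.
Qed.

End FockSpace.

(** * Interior and exterior blocks of noncrossing partitions *)

Section Partitions.
Variable T : finType.
Implicit Types (P : {set {set T}}) (D V U : {set T}) (m : T).

Lemma partition_block_eq P D V U i :
  partition P D -> V \in P -> U \in P -> i \in V -> i \in U -> V = U.
Proof.
case/and3P => _ tr _ VP UP iV iU.
by rewrite -(def_pblock tr VP iV) (def_pblock tr UP iU).
Qed.

Lemma partition_add P D V m : m \notin D -> partition P D -> V \in P ->
  partition ((m |: V) |: (P :\ V)) (m |: D).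
Proof.
move=> mD hP VP; have VD := partitionS hP VP.
have -> : m |: D = (m |: V) :|: (D :\: V).
  apply/setP => i; rewrite !inE; have := subsetP VD i.
  by case: (i == m) (i \in V) (i \in D) => [] [] [] //= ->.
apply: partitionU1; first exact: partitionD1.
  by apply/set0Pn; exists m; rewrite setU11.
rewrite -setI_eq0; apply/eqP/setP => i; rewrite !inE.
by case: eqP => [->|_] /=; rewrite ?(negbTE mD) ?andbF //; case: (i \in V).
Qed.

(** Undoes the insertion of [m]. It gives every partition a predecessor, and shows that insertions
    into different partitions have different results. *)
Definition remove_point m P : {set {set T}} :=
  let B := pblock P m in
  if B == [set m] then P :\ B else (B :\ m) |: (P :\ B).

Lemma remove_point_new P D m : m \notin D -> partition P D ->
  remove_point m ([set m] |: P) = P.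
Proof.
move=> mD hP.
have nP : [set m] \notin P.
  by apply: contra mD => /(partitionS hP)/subsetP; apply; rewrite inE.
have hP' : partition ([set m] |: P) (m |: D).
  apply: partitionU1 => //; first by apply/set0Pn; exists m; rewrite inE.
  by rewrite disjoints1.
case/and3P: (hP') => _ tr _.
rewrite /remove_point (def_pblock tr (B := [set m])) ?setU11 ?inE // eqxx.
by rewrite setU1K.
Qed.

Lemma remove_point_add P D V m : m \notin D -> partition P D -> V \in P ->
  remove_point m ((m |: V) |: (P :\ V)) = P.
Proof.
move=> mD hP VP; have VD := partitionS hP VP.
have hP' := partition_add mD hP VP.
have mV : m \notin V by apply: contra mD; apply: subsetP.
have nP : (m |: V) \notin P :\ V.
  apply: contra mD; rewrite inE => /andP[_ /(partitionS hP)/subsetP]; apply.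
  exact: setU11.
have V0 : V != set0 by apply: contraTneq VP => ->; case/and3P: hP.
case/and3P: (hP') => _ tr _.
rewrite /remove_point (def_pblock tr (B := m |: V)) ?setU11 // setU1K //.
case: eqP => [e|_].
  case/set0Pn: V0 => i iV; have := setU1r m iV; rewrite e inE => /eqP im.
  by rewrite -im iV in mV.
by rewrite setU1K // setD1K.
Qed.

Lemma partition_remove_point P D m : m \notin D -> partition P (m |: D) ->
  partition (remove_point m P) D.
Proof.
move=> mD hP; have [/eqP cv tr n0] := and3P hP.
have mc : m \in cover P by rewrite cv setU11.
have BP := pblock_mem mc; have mB : m \in pblock P m by rewrite mem_pblock.
rewrite /remove_point; move: (pblock P m) BP mB => B BP mB.
have hPB := partitionD1 hP BP.
case: eqP => [e|/eqP ne].
  rewrite e in hPB *; congr (is_true (partition _ _)): hPB.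
  by rewrite setU1K.
have BD := subsetP (partitionS hP BP).
have -> : D = (B :\ m) :|: ((m |: D) :\: B).
  apply/setP => i; rewrite !inE; have := BD i; rewrite !inE.
  have [->|_] /= := eqVneq i m; first by rewrite mB (negbTE mD).
  by case: (i \in B) (i \in D) => [] [] //= ->.
apply: partitionU1 => //.
  apply: contraNneq ne => e; apply/eqP/setP => i; rewrite inE.
  have := in_set0 i; rewrite -e !inE; have [->|//] := eqVneq i m.
  by rewrite mB.
rewrite -setI_eq0; apply/eqP/setP => i; rewrite !inE.
by case: (i \in B); rewrite /= ?andbF.
Qed.

End Partitions.

Lemma pairwise_sep (T : eqType) (r : rel T) (s : seq T) x y :
  pairwise r s -> x \in s -> y \in s -> x != y -> r x y \/ r y x.
Proof.
elim: s => //= z s IH /andP[/allP h /IH IHs]; rewrite !inE.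
case/predU1P => [->|xs] /predU1P[->|ys]; rewrite ?eqxx // => ne.
- by left; apply: h.
- by right; apply: h.
- exact: IHs.
Qed.

Lemma uniq_cat_mid (T : eqType) (s t : seq T) x :
  uniq (s ++ x :: t) = (x \notin s ++ t) && uniq (s ++ t).
Proof. by rewrite -cat1s uniq_catCA. Qed.

Lemma pairwise_rev (T : Type) (r : rel T) (s : seq T) :
  pairwise r (rev s) = pairwise (fun x y => r y x) s.
Proof.
by elim: s => //= x s IH; rewrite rev_cons pairwise_rcons all_rev IH.
Qed.

(** * Noncrossing partitions under the addition of a minimal point *)

Section Noncrossing.
Variable T : finType.
Implicit Types (R : rel T) (P : {set {set T}}) (D E V U : {set T}) (m : T).

Definition noncrossing_for R P : Prop := forall V U i j k l,
  V \in P -> U \in P -> V != U ->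
  i \in V -> j \in U -> k \in V -> l \in U -> R i j -> R j k -> R k l -> False.

Definition before R V U : bool := [forall i in V, forall j in U, R i j].

(** Some two points of [U] enclose [V]; they need not be its extremes, which spares recomputing
    minima and maxima when a block grows. *)
Definition nested R V U : Prop :=
  exists x y, [/\ x \in U, y \in U & forall i, i \in V -> R x i /\ R i y].

Lemma beforeP R V U i j : before R V U -> i \in V -> j \in U -> R i j.
Proof. by move=> /forall_inP h /h/forall_inP; apply. Qed.

(** A noncrossing partition, presented by the list of its interior blocks and
    the ordered list of its exterior blocks. *)
Definition diagram : Type := (seq {set T} * seq {set T})%type.

Definition blocks_of (c : diagram) : {set {set T}} := [set V in c.1 ++ c.2].

(** The invariant of the enumeration. The predicate [ok] on single blocks will say that a block has
    one colour. *)
Record good (ok : {set T} -> Prop) R D (c : diagram) : Prop := Good {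
  good_uniq : uniq (c.1 ++ c.2);
  good_partition : partition (blocks_of c) D;
  good_nc : noncrossing_for R (blocks_of c);
  good_sorted : pairwise (before R) c.2;
  good_nested : forall V, V \in c.1 -> exists2 U, U \in c.2 & nested R V U;
  good_ok : forall V, V \in blocks_of c -> ok V
}.

Definition flip_rel R : rel T := fun i j => R j i.

Lemma noncrossing_flip R P :
  noncrossing_for R P -> noncrossing_for (flip_rel R) P.
Proof.
move=> h V U i j k l VP UP ne iV jU kV lU ij jk kl.
by apply: (h U V l k j i) => //; rewrite eq_sym.
Qed.

Lemma blocks_of_rev I L : blocks_of (I, rev L) = blocks_of (I, L).
Proof. by apply/setP => V; rewrite !inE !mem_cat mem_rev. Qed.

Lemma good_flip ok R D I L :
  good ok R D (I, L) -> good ok (flip_rel R) D (I, rev L).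
Proof.
case=> /= un hp nc so ne hok; split; rewrite ?blocks_of_rev //=.
- rewrite cat_uniq rev_uniq (eq_has_r (mem_rev L)).
  by move: un; rewrite cat_uniq.
- exact: noncrossing_flip.
- rewrite pairwise_rev; apply: sub_pairwise so => V U h.
  by apply/forall_inP => i iU; apply/forall_inP => j jV; apply: beforeP h _ _.
- move=> V /ne[U UL [x [y [xU yU h]]]]; exists U; first by rewrite mem_rev.
  by exists y, x; split=> // i /h[].
Qed.

Section Extend.
Variables (ok : {set T} -> Prop) (R : rel T) (D : {set T}) (m : T).
Hypothesis R_trans : transitive R.
Hypothesis R_irr : irreflexive R.
Hypothesis mD : m \notin D.
Hypothesis m_min : forall i, i \in D -> R m i.

Lemma blocks_of_new I L : blocks_of (I, [set m] :: L) = [set m] |: blocks_of (I, L).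
Proof. by apply/setP => V; rewrite !inE !mem_cat inE orbCA. Qed.

Lemma blocks_of_absorb I pre E suf : uniq (I ++ pre ++ E :: suf) ->
  blocks_of (rev pre ++ I, (m |: E) :: suf) =
  (m |: E) |: (blocks_of (I, pre ++ E :: suf) :\ E).
Proof.
move=> un; apply/setP => V; rewrite !inE !mem_cat mem_rev !inE.
have [->|ne] := eqVneq V E; last by do !case: (V \in _); rewrite ?orbT.
rewrite andFb orbF.
have : E \notin I ++ pre ++ suf.
  by move: un; rewrite catA uniq_cat_mid -catA => /andP[].
by rewrite !mem_cat; do !case: (E \in _); rewrite ?orbF.
Qed.

Lemma good_new I L : ok [set m] -> good ok R D (I, L) ->
  good ok R (m |: D) (I, [set m] :: L).
Proof.
move=> okm [/= un hp nc so ne hok].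
have mV V : V \in blocks_of (I, L) -> m \notin V.
  by move=> /(partitionS hp)/subsetP VD; apply: contra mD; apply: VD.
have nP : [set m] \notin blocks_of (I, L) by apply/negP => /mV; rewrite inE eqxx.
have VD V i : V \in blocks_of (I, L) -> i \in V -> R m i.
  by move=> /(partitionS hp)/subsetP h /h/m_min.
split; rewrite ?blocks_of_new /=.
- by rewrite -cat1s uniq_catCA /= un andbT; move: nP; rewrite inE.
- apply: partitionU1 => //; first by apply/set0Pn; exists m; rewrite inE.
  by rewrite disjoints1.
- move=> V U i j k l /setU1P[->|VP] /setU1P[->|UP]; rewrite ?eqxx // => VU.
  + by rewrite !inE => /eqP -> jU /eqP -> lU mj jm; have := R_trans mj jm; rewrite R_irr.
  + by rewrite !inE => iV /eqP -> kV /eqP -> _ mk km; have := R_trans mk km; rewrite R_irr.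
  + exact: nc.
- rewrite so andbT; apply/allP => U UL; apply/forall_inP => i /set1P ->.
  by apply/forall_inP => j; apply: VD; rewrite inE mem_cat UL orbT.
- by move=> V /ne[U UL h]; exists U; rewrite // inE UL orbT.
- by move=> V /setU1P[->|/hok].
Qed.

(** The blocks of [pre] lie between [m] and any point of [E], so they become nested in [m |: E], and
    so does everything that was nested in them. The blocks of [suf] stay to the right. *)
Lemma good_absorb I pre E suf : ok (m |: E) -> good ok R D (I, pre ++ E :: suf) ->
  good ok R (m |: D) (rev pre ++ I, (m |: E) :: suf).
Proof.
move=> okm [/= un hp nc so ne hok].
set P := blocks_of (I, pre ++ E :: suf) in hp nc hok.
have mV V : V \in P -> m \notin V.
  by move=> /(partitionS hp)/subsetP VD; apply: contra mD; apply: VD.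
have VD V i : V \in P -> i \in V -> R m i.
  by move=> /(partitionS hp)/subsetP h /h/m_min.
have preP V : V \in pre -> V \in P by rewrite !inE !mem_cat => ->; rewrite orbT.
have sufP V : V \in suf -> V \in P by rewrite !inE !mem_cat inE => ->; rewrite !orbT.
have IP V : V \in I -> V \in P by rewrite !inE !mem_cat => ->.
have EP : E \in P by rewrite !inE !mem_cat inE eqxx !orbT.
have PE := blocks_of_absorb un; rewrite -/P in PE.
have [e eE] : exists e, e \in E.
  by apply/set0Pn; apply: contraTneq EP => ->; case/and3P: hp.
move: so; rewrite pairwise_cat /= => /and4P[/allrelP preR _ /allP Esuf so].
have preE V : V \in pre -> before R V E.
  by move=> Vp; apply: preR; rewrite ?mem_head.
have R_as i j : R i j -> R j i -> False.
  by move=> ij /(R_trans ij); rewrite R_irr.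
(* No point of [E] lies between two points of another block [V]. For exterior [V] this is the linear
   order of exterior blocks; for interior [V], nested in [W], it follows from the position of [W],
   or from noncrossing when [W] is [E]. *)
have key V U i j k : V \in P -> V != E -> i \in E -> j \in V -> k \in V ->
    R j i -> R i k -> False.
  move=> VP VE iE jV kV ji ik.
  have [VI|] := boolP (V \in I); last first.
    move: VP; rewrite !inE !mem_cat inE (negbTE VE) /= => /or3P[->//|Vp|Vs] _.
      by apply: R_as ik _; apply: beforeP (preE _ Vp) _ _.
    by apply: R_as ji _; apply: beforeP (Esuf _ Vs) _ _.
  have [W WL [x [y [xW yW h]]]] := ne V VI.
  have [xj jy] := h j jV; have [xk ky] := h k kV.
  move: WL; rewrite mem_cat inE => /or3P[Wp|/eqP WE|Ws].
  - by apply: (R_as i y); [exact: R_trans ik ky|exact: beforeP (preE _ Wp) _ _].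
  - rewrite WE in xW; apply: (nc E V x j i k) => //; first by rewrite eq_sym.
  - by apply: (R_as x i); [exact: R_trans xj ji|exact: beforeP (Esuf _ Ws) _ _].
split; rewrite ?PE /=.
- move: un; rewrite catA !uniq_cat_mid => /andP[_ un]; apply/andP; split.
    apply/negP; rewrite -catA !mem_cat mem_rev.
    by move=> /or3P[/preP|/IP|/sufP] /mV; rewrite setU11.
  rewrite (perm_uniq (s2 := (I ++ pre) ++ suf)) // perm_cat2r.
  by rewrite perm_catC perm_cat2l perm_rev.
- exact: partition_add.
- move=> V U i j k l /setU1P[->|/setD1P[VE VP]] /setU1P[->|/setD1P[UE UP]];
    rewrite ?eqxx // => VU; last exact: nc.
  + move=> iV jU kV lU ij jk kl.
    have kE : k \in E.
      move: kV => /setU1P[km|//]; case: (R_as j k) => //.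
      by rewrite km; apply: VD jU.
    case/setU1P: iV => [im|iE]; first by apply: (key U U k j l).
    by apply: (nc E U i j k l) => //; rewrite eq_sym.
  + move=> iV jU kV lU ij jk kl.
    (* A point to the right of a point of [V] is not [m], so the crossing already occurs between [V]
       and [E]. *)
    have big x y : x \in V -> y \in m |: E -> R x y -> y \in E.
      move=> xV /setU1P[->|//] xm; case: (R_as x m) => //; exact: VD xV.
    by apply: (nc V E i j k l) => //; [exact: big ij|exact: big kl].
- rewrite so andbT; apply/allP => U Us; apply/forall_inP => i /setU1P[->|iE].
    by apply/forall_inP => j; apply: VD; apply: sufP.
  by have /forall_inP := Esuf _ Us; apply.
- have pre_nested V : V \in pre -> nested R V (m |: E).
    move=> Vp; exists m, e; split; rewrite ?setU11 ?setU1r // => i iV.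
    by split; [exact: VD (preP _ Vp) iV|exact: beforeP (preE _ Vp) _ _].
  move=> V; rewrite mem_cat mem_rev => /orP[Vp|VI].
    by exists (m |: E); rewrite ?mem_head //; exact: pre_nested.
  have [U UL [x [y [xU yU h]]]] := ne _ VI.
  move: UL; rewrite mem_cat inE => /or3P[Up|/eqP UE|Us].
  + exists (m |: E); rewrite ?mem_head //.
    exists m, e; split; rewrite ?setU11 ?setU1r // => i iV; have [xi iy] := h i iV.
    split; first by apply: VD iV; apply: IP.
    by apply: R_trans iy _; apply: beforeP (preE _ Up) _ _.
  + by exists (m |: E); rewrite ?mem_head //; exists x, y; rewrite -UE !setU1r.
  + by exists U; [rewrite inE Us orbT|exists x, y].
- by move=> V /setU1P[->//|/setD1P[_ /hok]].
Qed.

(** A minimal point cannot join an interior block: it would cross the block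
    that surrounds it. *)
Lemma interior_not_extended Q I L E B :
  good ok R D (I, L) -> E \in I -> noncrossing_for R Q ->
  B \in Q -> m \in B -> E \subset B ->
  (forall U, U \in L -> U \in Q /\ U != B) -> False.
Proof.
move=> [/= un hp nc so ne hok] EI ncQ BQ mB /subsetP EB LQ.
have [U UL [x [y [xU yU h]]]] := ne _ EI; have [UQ UB] := LQ _ UL.
have EP : E \in blocks_of (I, L) by rewrite inE mem_cat EI.
have UP : U \in blocks_of (I, L) by rewrite inE mem_cat UL orbT.
have [e eE] : exists e, e \in E.
  by apply/set0Pn; apply: contraTneq EP => ->; case/and3P: hp.
have [xe ey] := h e eE.
apply: (ncQ B U m x e y) => //; rewrite ?EB //; first by rewrite eq_sym.
by apply: m_min; apply: subsetP (partitionS hp UP) _ xU.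
Qed.

End Extend.
End Noncrossing.

(** * All ways of inserting a minimal point *)

Section FreshPoint.
Variables (T : finType) (ok : {set T} -> Prop) (R : rel T) (D : {set T}) (m : T).
Variable joinable : {set T} -> bool.
Hypothesis R_trans : transitive R.
Hypothesis R_irr : irreflexive R.
Hypothesis mD : m \notin D.
Hypothesis m_min : forall i, i \in D -> R m i.
Hypothesis ok1 : ok [set m].
Hypothesis joinableP : forall E, E != set0 -> m \notin E -> ok E ->
  joinable E <-> ok (m |: E).

(** The blocks [E :: I] that are passed over when [m] joins a later exterior
    block become interior. *)
Fixpoint absorb (I L : seq {set T}) : seq (diagram T) :=
  if L is E :: L' then
    (if joinable E then [:: (I, (m |: E) :: L')] else [::]) ++ absorb (E :: I) L'
  else [::].

Definition insert_min (c : diagram T) : seq (diagram T) :=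
  (c.1, [set m] :: c.2) :: absorb c.1 c.2.

Lemma absorbP I L c : reflect
  (exists pre E suf, [/\ L = pre ++ E :: suf, joinable E &
     c = (rev pre ++ I, (m |: E) :: suf)]) (c \in absorb I L).
Proof.
elim: L I c => [|E L IH] I c /=.
  by constructor => -[[|? ?] [? [? []]]].
rewrite mem_cat; apply: (iffP orP) => [[|/IH[pre [E' [suf [-> jE ->]]]]]|].
- by case: ifP => // jE; rewrite inE => /eqP ->; exists [::], E, L.
- by exists (E :: pre), E', suf; rewrite rev_cons cat_rcons.
- case=> -[|E' pre] [F [suf [/= [-> eL] jF ->]]]; first by left; rewrite jF -eL inE.
  by right; apply/IH; exists pre, F, suf; rewrite rev_cons cat_rcons.
Qed.

Lemma absorb_head I L :
  [seq head set0 c.2 | c <- absorb I L] = [seq m |: E | E <- L & joinable E].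
Proof. by elim: L I => //= E L IH I; rewrite map_cat IH; case: ifP. Qed.

Lemma good_block I L V : good ok R D (I, L) -> V \in I ++ L ->
  [/\ V != set0, m \notin V & ok V].
Proof.
case=> /= _ hp _ _ _ hok VIL; have VP : V \in blocks_of (I, L) by rewrite inE.
split; last exact: hok.
  by apply: contraTneq VP => ->; case/and3P: hp.
by apply: contra mD; apply: subsetP (partitionS hp VP) m.
Qed.

Lemma good_insert c c' : good ok R D c -> c' \in insert_min c ->
  good ok R (m |: D) c'.
Proof.
case: c => I L g; rewrite inE => /predU1P[->|/absorbP[pre [E [suf [/= eL jE ->]]]]].
  exact: good_new.
rewrite eL in g.
have [|E0 mE okE] := good_block (V := E) g; first by rewrite !mem_cat inE eqxx !orbT.
by apply: good_absorb g => //; apply/joinableP.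
Qed.

Lemma remove_point_insert c c' : good ok R D c -> c' \in insert_min c ->
  remove_point m (blocks_of c') = blocks_of c.
Proof.
case: c => I L g; have hp := good_partition g.
rewrite inE => /predU1P[->|/absorbP[pre [E [suf [/= eL jE ->]]]]].
  by rewrite blocks_of_new (remove_point_new mD).
rewrite eL in g hp *; rewrite blocks_of_absorb ?(good_uniq g) // (remove_point_add mD) //.
by rewrite inE !mem_cat inE eqxx !orbT.
Qed.

(** The results are told apart by the block of [m], which stands first among the exterior blocks: it
    is [[set m]], or [m |: E] for distinct nonempty [E] that do not contain [m]. *)
Lemma uniq_insert c : good ok R D c -> uniq (map (@blocks_of T) (insert_min c)).
Proof.
case: c => I L g; apply: (@map_uniq _ _ (fun P => pblock P m)).
rewrite -map_comp.
have /eq_in_map -> : {in insert_min (I, L),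
    (fun P => pblock P m) \o @blocks_of T =1 fun c => head set0 c.2}.
  move=> c' hc' /=; have g' := good_insert g hc'.
  case/and3P: (good_partition g') => _ tr _.
  move: hc'; rewrite inE => /predU1P[e|/absorbP[pre [E [suf [_ _ e]]]]];
    by rewrite e /= in tr *; apply: def_pblock; rewrite ?inE ?mem_cat ?inE ?eqxx ?orbT.
have gL V : V \in L -> V != set0 /\ m \notin V.
  move=> VL; have [|V0 mV _] := good_block (V := V) g; last by [].
  by rewrite mem_cat VL orbT.
rewrite /insert_min /= absorb_head; apply/andP; split.
  apply/mapP => -[E]; rewrite mem_filter => /andP[_ /gL[/set0Pn[e eE] mE]] h.
  have := setU1r m eE; rewrite -h => /set1P em.
  by rewrite -em eE in mE.
rewrite map_inj_in_uniq; last first.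
  move=> V U; rewrite !mem_filter => /andP[_ /gL[_ mV]] /andP[_ /gL[_ mU]] h.
  by rewrite -(setU1K mV) h setU1K.
by rewrite filter_uniq //; have := good_uniq g; rewrite cat_uniq => /and3P[].
Qed.

(** Without [m], the block of [m] in [P] is empty or a block [E] of [c]. By noncrossing [E] cannot
    be interior, so it is one of the blocks tried by [absorb]. *)
Lemma insert_surj c P : good ok R D c -> partition P (m |: D) ->
  noncrossing_for R P -> (forall V, V \in P -> ok V) ->
  blocks_of c = remove_point m P -> exists2 c', c' \in insert_min c & blocks_of c' = P.
Proof.
case: c => I L g hP ncP okP e.
have mc : m \in cover P by case/and3P: hP => /eqP -> _ _; rewrite setU11.
have := pblock_mem mc; have : m \in pblock P m by rewrite mem_pblock.
move: e; rewrite /remove_point; move: (pblock P m) => B e mB BP.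
case: eqP e => [eB|/eqP neB] e.
  exists (I, [set m] :: L); first by rewrite mem_head.
  by rewrite blocks_of_new e eB setD1K // -eB.
set E := B :\ m in e.
have EP : E \in blocks_of (I, L) by rewrite e setU11.
have [|E0 mE okE] := good_block (V := E) g; first by move: EP; rewrite inE.
have Bm : m |: E = B by rewrite setD1K.
have EL : E \in L.
  move: (EP); rewrite inE mem_cat => /orP[EI|//]; exfalso.
  apply: (interior_not_extended m_min g EI ncP BP mB); first exact: subsetDl.
  (* An exterior [U] differs from the interior [E], hence survives unchanged as a block of [P] other
     than [B]. *)
  move=> U UL; have : U \in blocks_of (I, L) by rewrite inE mem_cat UL orbT.
  rewrite e => /setU1P[UE|/setD1P[? ?]]; last by [].
  have := good_uniq g; rewrite cat_uniq => /and3P[_ /hasPn /(_ _ UL)].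
  by rewrite UE /= EI.
have jE : joinable E by apply/joinableP; rewrite // Bm; apply: okP.
have [pre [suf eL]] : exists pre suf, L = pre ++ E :: suf.
  by case/splitPr: EL => pre suf; exists pre, suf.
rewrite eL in g EP e *.
exists (rev pre ++ I, (m |: E) :: suf).
  by rewrite inE; apply/orP; right; apply/absorbP; exists pre, E, suf.
rewrite blocks_of_absorb ?(good_uniq g) // e setU1K ?Bm ?setD1K //.
apply/negP => /setD1P[EB EinP]; case/negP: EB; apply/eqP.
case/set0Pn: E0 => i iE; apply: (partition_block_eq hP EinP BP iE).
by rewrite -Bm setU1r.
Qed.

End FreshPoint.

Lemma remove_point_block (T : finType) (P : {set {set T}}) (D V : {set T}) m :
  m \notin D -> partition P (m |: D) -> V \in remove_point m P ->
  exists2 U, U \in P & V = U :\ m.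
Proof.
move=> mD hP.
have mc : m \in cover P by case/and3P: hP => /eqP -> _ _; rewrite setU11.
have := pblock_mem mc; have : m \in pblock P m by rewrite mem_pblock.
rewrite /remove_point; move: (pblock P m) => B mB BP.
have old U : U \in P :\ B -> exists2 U', U' \in P & U = U' :\ m.
  move=> /setD1P[UB UP]; exists U => //; apply/setP => i; rewrite !inE.
  have [->|//] := eqVneq i m; apply/negbTE; apply: contra UB => mU.
  by rewrite (partition_block_eq hP UP BP mU mB).
case: eqP => _; first exact: old.
by move=> /setU1P[->|/old//]; exists B.
Qed.

(** The map [g] recovers the value of the parent from that of a child, so children of different
    parents have different values. *)
Lemma uniq_flatten_map (A B : eqType) (f : A -> B) (g : B -> B)
    (ch : A -> seq A) (s : seq A) :
  uniq (map f s) -> (forall a, a \in s -> uniq (map f (ch a))) ->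
  (forall a a', a \in s -> a' \in ch a -> g (f a') = f a) ->
  uniq (map f (flatten (map ch s))).
Proof.
elim: s => //= a s IH /andP[as_ us] uch gf; rewrite map_cat cat_uniq uch ?mem_head //=.
rewrite IH // => [|b bs|b b' bs hb']; last first.
- by apply: gf; rewrite // inE bs orbT.
- by apply: uch; rewrite inE bs orbT.
rewrite andbT; apply/hasPn => _ /mapP[b' /flattenP[_ /mapP[b bs ->] hb'] ->].
apply: contra as_ => /mapP[a' ha' e].
by apply/mapP; exists b => //; rewrite -(gf a a') ?mem_head // -e (gf b b') // inE bs orbT.
Qed.

(** * The total order given by the sides *)

Section ChiOrder.
Variables (n : nat) (chi : 'I_n -> side).

Lemma chi_lt_trans : transitive (chi_lt chi).
Proof.
move=> j i k; rewrite /chi_lt; case: (chi i) (chi j) (chi k) => [] [] [] //.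
  exact: ltn_trans.
by move=> ji kj; apply: ltn_trans ji.
Qed.

Lemma chi_lt_irr : irreflexive (chi_lt chi).
Proof. by move=> i; rewrite /chi_lt; case: (chi i); rewrite ltnn. Qed.

Lemma chi_lt_total i j : i != j -> chi_lt chi i j || chi_lt chi j i.
Proof.
rewrite /chi_lt -val_eqE /=.
by case: (chi i) (chi j) => [] [] //; rewrite neq_ltn // orbC.
Qed.

End ChiOrder.

(** * Enumeration of the noncrossing partitions with one-coloured blocks *)

Section Enumeration.
Variables (K : eqType) (L : choiceType) (col : L -> K) (sd : L -> side).
Variables (n : nat) (x : 'I_n -> L).
Local Notation T := 'I_n.
Local Notation chi := (fun i => sd (x i)).

(** The letters are in the order of the indices, as in the arguments of a cumulant, and not in the
    order [chi_lt]. *)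
Definition word_block (V : {set T}) : seq L := [seq x i | i <- enum V].

Definition one_colour (V : {set T}) : Prop :=
  forall i j, i \in V -> j \in V -> col (x i) = col (x j).

Definition joinable (m : T) (E : {set T}) : bool :=
  hascol col (col (x m)) (word_block E).

Lemma hascol_word_block E i : one_colour E -> i \in E -> forall k,
  hascol col k (word_block E) = (col (x i) == k).
Proof.
move=> okE iE k; rewrite /word_block.
have := mem_enum E i; rewrite iE; have : {subset enum E <= E} by move=> ?; rewrite mem_enum.
case: (enum E) => //= j s /(_ j (mem_head _ _)) jE _.
by rewrite (okE i j).
Qed.

Lemma joinableP m E : E != set0 -> m \notin E -> one_colour E ->
  joinable m E <-> one_colour (m |: E).
Proof.
move=> /set0Pn[e eE] mE okE; rewrite /joinable (hascol_word_block okE eE).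
split=> [/eqP h|h]; last by apply/eqP; apply: h; rewrite ?setU11 ?setU1r.
have hm i : i \in E -> col (x i) = col (x m) by move=> iE; rewrite -h; apply: okE.
move=> i j /setU1P[->|iE] /setU1P[->|jE] //; rewrite ?hm //.
Qed.

Lemma one_colour1 m : one_colour [set m].
Proof. by move=> i j /set1P -> /set1P ->. Qed.

(** A right letter is the last one in the order [chi_lt]; reversing that order
    reduces its insertion to the one of a minimal point. *)
Definition mirror (c : diagram T) : diagram T := (c.1, rev c.2).

Lemma blocks_of_mirror c : blocks_of (mirror c) = blocks_of c.
Proof. by case: c => I J; apply: blocks_of_rev. Qed.

Lemma good_mirror ok R D c : good ok R D c -> good ok (flip_rel R) D (mirror c).
Proof. by case: c => I J; apply: good_flip. Qed.

Definition insert (m : T) (c : diagram T) : seq (diagram T) :=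
  if sd (x m) is Left then insert_min m (joinable m) c
  else map mirror (insert_min m (joinable m) (mirror c)).

(** Indices are inserted from the last to the first, as the operators of a product reach the
    state-vector. An index smaller than all present ones is minimal for [chi_lt] if it is left and
    maximal if it is right. *)
Definition diagrams (s : seq T) : seq (diagram T) :=
  foldr (fun m cs => flatten (map (insert m) cs)) [:: ([::], [::])] s.

Section Insert.
Variables (m : T) (D : {set T}).
Hypothesis m_ltn : forall i, i \in D -> (m < i)%N.
Local Notation goodD := (good one_colour (chi_lt chi)).

Let mD : m \notin D.
Proof. by apply/negP => /m_ltn; rewrite ltnn. Qed.

Let min_l : sd (x m) = Left -> forall i, i \in D -> chi_lt chi m i.
Proof. by move=> e i /m_ltn; rewrite /chi_lt e; case: (sd (x i)). Qed.

Let min_r : sd (x m) = Right -> forall i, i \in D -> flip_rel (chi_lt chi) m i.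
Proof. by move=> e i /m_ltn; rewrite /flip_rel /chi_lt e; case: (sd (x i)). Qed.

Let flip_trans : transitive (flip_rel (chi_lt chi)).
Proof. by move=> j i k ji kj; apply: chi_lt_trans ji. Qed.

Let flip_irr : irreflexive (flip_rel (chi_lt chi)).
Proof. by move=> i; rewrite /flip_rel chi_lt_irr. Qed.

Lemma insert_good c c' : goodD D c -> c' \in insert m c -> goodD (m |: D) c'.
Proof.
rewrite /insert; case e: (sd (x m)) => g.
  exact: (good_insert (@chi_lt_trans _ _) (@chi_lt_irr _ _) mD (min_l e)
    (@one_colour1 m) (@joinableP m)).
case/mapP => d hd ->; apply: (good_mirror (R := flip_rel (chi_lt chi))).
exact: (good_insert flip_trans flip_irr mD (min_r e)
  (@one_colour1 m) (@joinableP m) (good_mirror g) hd).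
Qed.

Lemma insert_remove_point c c' : goodD D c -> c' \in insert m c ->
  remove_point m (blocks_of c') = blocks_of c.
Proof.
rewrite /insert; case: (sd (x m)) => g; first exact: (remove_point_insert mD g).
case/mapP => d hd ->; rewrite blocks_of_mirror -(blocks_of_mirror c).
exact: (remove_point_insert mD (good_mirror g) hd).
Qed.

Lemma insert_uniq c : goodD D c -> uniq (map (@blocks_of T) (insert m c)).
Proof.
rewrite /insert; case e: (sd (x m)) => g.
  exact: (uniq_insert (@chi_lt_trans _ _) (@chi_lt_irr _ _) mD (min_l e)
    (@one_colour1 m) (@joinableP m) g).
rewrite -map_comp (eq_map (g := @blocks_of T)); last exact: blocks_of_mirror.
exact: (uniq_insert flip_trans flip_irr mD (min_r e)
  (@one_colour1 m) (@joinableP m) (good_mirror g)).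
Qed.

Lemma insert_onto c P : goodD D c -> partition P (m |: D) ->
  noncrossing_for (chi_lt chi) P -> (forall V, V \in P -> one_colour V) ->
  blocks_of c = remove_point m P -> exists2 c', c' \in insert m c & blocks_of c' = P.
Proof.
rewrite /insert; case e: (sd (x m)) => g hP nc ok1 eP.
  exact: (insert_surj mD (min_l e) (@joinableP m) g hP nc ok1 eP).
have [|c' hc' <-] := insert_surj mD (min_r e) (@joinableP m) (good_mirror g) hP
  (noncrossing_flip nc) ok1; first by rewrite blocks_of_mirror.
by exists (mirror c'); rewrite ?blocks_of_mirror // map_f.
Qed.

End Insert.

Definition increasing : rel T := fun i j => (i < j)%N.

Lemma path_increasing m s : path increasing m s ->
  forall i, i \in [set i in s] -> (m < i)%N.
Proof.
move=> h i; rewrite inE => is_; have := order_path_min _ h.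
by move=> /(_ (fun _ _ _ => @ltn_trans _ _ _))/allP; apply.
Qed.

Lemma set_cons m (s : seq T) : [set i in m :: s] = m |: [set i in s].
Proof. by apply/setP => i; rewrite !inE. Qed.

Lemma diagrams_good s c : sorted increasing s -> c \in diagrams s ->
  good one_colour (chi_lt chi) [set i in s] c.
Proof.
elim: s c => [|m s IH] c.
  move=> _; rewrite inE => /eqP ->; split=> //=.
  - apply/and3P; split; last by rewrite inE in_nil.
      rewrite /cover big_pred0 => [|V]; last by rewrite inE.
      by apply/eqP/setP => i; rewrite !inE.
    by apply/trivIsetP => V U; rewrite inE.
  - by move=> V U i j k l; rewrite inE.
  - by move=> V; rewrite inE.
move=> /= so /flattenP[_ /mapP[d hd ->] hc]; rewrite set_cons.
by apply: insert_good hc; [exact: path_increasing|apply: IH (path_sorted so) hd].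
Qed.

Lemma diagrams_uniq s : sorted increasing s -> uniq (map (@blocks_of T) (diagrams s)).
Proof.
elim: s => [|m s IH] // so; have so' := path_sorted so; have hm := path_increasing so.
apply: (uniq_flatten_map (g := remove_point m)) => [|c hc|c c' hc hc']; first exact: IH.
- exact: insert_uniq hm _ (diagrams_good so' hc).
- exact: insert_remove_point hm _ _ (diagrams_good so' hc) hc'.
Qed.

(** Erase the first index, apply induction, and insert the index again. Erasing preserves
    noncrossing and colour because every remaining block is part of an old one. *)
Lemma diagrams_onto s P : sorted increasing s -> partition P [set i in s] ->
  noncrossing_for (chi_lt chi) P -> (forall V, V \in P -> one_colour V) ->
  exists2 c, c \in diagrams s & blocks_of c = P.
Proof.
elim: s P => [|m s IH] P so hP nc ok1.
  exists ([::], [::]); first by rewrite inE.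
  apply/setP => V; rewrite inE; symmetry; apply/negbTE/negP => VP.
  have [/eqP cv _ n0] := and3P hP; case/negP: n0.
  have : V \subset [set i in [::]] by apply: partitionS VP.
  suff -> : [set i in [::]] = set0 :> {set T} by rewrite subset0 => /eqP <-.
  by apply/setP => i; rewrite !inE.
have so' := path_sorted so; have hm := path_increasing so.
have mD : m \notin [set i in s] by apply/negP => /hm; rewrite ltnn.
rewrite set_cons in hP; have sb := remove_point_block mD hP.
have [||c hc e] := IH (remove_point m P) so' (partition_remove_point mD hP).
- move=> V U i j k l /sb[V' VP ->] /sb[U' UP ->] ne.
  rewrite !inE => /andP[_ iV] /andP[_ jU] /andP[_ kV] /andP[_ lU].
  apply: (nc V' U' i j k l) => //.
  by apply: contraNneq ne => ->.
- move=> V /sb[V' VP ->] i j; rewrite !inE => /andP[_ iV] /andP[_ jV].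
  exact: ok1 VP _ _ iV jV.
have [c' hc' ec'] := insert_onto hm (diagrams_good so' hc) hP nc ok1 e.
by exists c' => //; apply/flattenP; exists (insert m c); rewrite // map_f.
Qed.

End Enumeration.

(** * Agreement with the definition of interior blocks by minima and maxima *)

Section InteriorBlocks.
Variables (n : nat) (chi : 'I_n -> side).
Local Notation T := 'I_n.
Local Notation lt := (chi_lt chi).
Implicit Types (V U W : {set T}) (ok : {set T} -> Prop) (D : {set T}).

Lemma chi_min_lt V i j : chi_min chi V i -> j \in V -> j != i -> lt i j.
Proof. by move=> /andP[_ /forall_inP h] /h/implyP. Qed.

Lemma chi_max_lt V i j : chi_max chi V i -> j \in V -> j != i -> lt j i.
Proof. by move=> /andP[_ /forall_inP h] /h/implyP. Qed.

(** The number of predecessors is a numerical rank, whose extreme values on a block locate its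
    minimum and maximum. *)
Lemma chi_lt_mono (r : rel T) : transitive r -> irreflexive r ->
  forall i j, r i j -> (#|[set k | r k i]| < #|[set k | r k j]|)%N.
Proof.
move=> tr irr i j ij; apply: proper_card; apply/properP; split.
  by apply/subsetP => k; rewrite !inE => /tr; apply.
by exists i; rewrite !inE ?irr.
Qed.

Lemma ex_chi_min V : V != set0 -> exists i, chi_min chi V i.
Proof.
case/set0Pn => i0 i0V; pose f i := #|[set k | lt k i]|.
case: (arg_minnP f i0V) => i iV hi; exists i; rewrite /chi_min [_ \in _]iV /=.
apply/forall_inP => j jV; apply/implyP => ne.
case/orP: (chi_lt_total chi ne) => // ji.
have := chi_lt_mono (@chi_lt_trans _ chi) (@chi_lt_irr _ chi) ji.
by rewrite ltnNge -/(f i) -/(f j) hi.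
Qed.

Lemma ex_chi_max V : V != set0 -> exists i, chi_max chi V i.
Proof.
case/set0Pn => i0 i0V; pose f i := #|[set k | lt k i]|.
case: (arg_maxnP f i0V) => i iV hi; exists i; rewrite /chi_max [_ \in _]iV /=.
apply/forall_inP => j jV; apply/implyP => ne.
case/orP: (chi_lt_total chi ne) => // ij.
have := chi_lt_mono (@chi_lt_trans _ chi) (@chi_lt_irr _ chi) ij.
by have hj : (f j <= f i)%N := hi j jV; rewrite ltnNge -/(f i) -/(f j) hj.
Qed.

Lemma chi_min_nested V U x i j : chi_min chi U i -> chi_min chi V j ->
  x \in U -> (forall k, k \in V -> lt x k) -> lt i j.
Proof.
move=> mi /andP[jV _] xU h; have [<-|ne] := eqVneq x i; first exact: h.
exact: chi_lt_trans (chi_min_lt mi xU ne) (h _ jV).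
Qed.

Lemma chi_max_nested V U y i j : chi_max chi V i -> chi_max chi U j ->
  y \in U -> (forall k, k \in V -> lt k y) -> lt i j.
Proof.
move=> /andP[iV _] mj yU h; have [<-|ne] := eqVneq y j; first exact: h.
exact: chi_lt_trans (h _ iV) (chi_max_lt mj yU ne).
Qed.

Variables (ok : {set T} -> Prop) (D : {set T}) (c : diagram T).
Hypothesis gc : good ok lt D c.

Let block0 V : V \in blocks_of c -> V != set0.
Proof.
by move=> VP; apply: contraTneq VP => ->; case/and3P: (good_partition gc).
Qed.

Lemma interior_in V : V \in c.1 -> interior_block chi (blocks_of c) V.
Proof.
move=> VI; have [U UL [x [y [xU yU h]]]] := good_nested gc VI.
have VP : V \in blocks_of c by rewrite inE mem_cat VI.
have UP : U \in blocks_of c by rewrite inE mem_cat UL orbT.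
have [i mi] := ex_chi_min (block0 UP); have [j mj] := ex_chi_min (block0 VP).
have [i' Mi] := ex_chi_max (block0 VP); have [j' Mj] := ex_chi_max (block0 UP).
apply/exists_inP; exists U => //; apply/and3P; split.
- apply: contraTneq xU => ->; apply/negP => /h[].
  by rewrite (chi_lt_irr chi).
- apply/existsP; exists i; apply/existsP; exists j; rewrite mi mj /=.
  by apply: chi_min_nested mi mj xU _ => k /h[].
- apply/existsP; exists i'; apply/existsP; exists j'; rewrite Mi Mj /=.
  by apply: chi_max_nested Mi Mj yU _ => k /h[].
Qed.

(** Suppose [U] surrounds [V]. If [U] is exterior, the linear order of exterior blocks is violated.
    If [U] is interior, the exterior [W] around it also surrounds [V]; the case [W = V] would give
    [V] a point below its minimum. *)
Lemma exterior_in V : V \in c.2 -> ~~ interior_block chi (blocks_of c) V.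
Proof.
move=> VL; apply/negP => /exists_inP[U UP /and3P[UV]].
move=> /existsP[i /existsP[j /and3P[mi mj ij]]].
move=> /existsP[i' /existsP[j' /and3P[Mi Mj ij']]].
have asym a b : lt a b -> lt b a -> False.
  by move=> ab ba; have := chi_lt_trans ab ba; rewrite chi_lt_irr.
have [iU jV] : i \in U /\ j \in V by case/andP: mi; case/andP: mj.
have [iV' jU'] : i' \in V /\ j' \in U by case/andP: Mi; case/andP: Mj.
have ext W a b : W \in c.2 -> W != V -> a \in W -> b \in W ->
    lt a j -> lt i' b -> False.
  move=> WL ne aW bW aj ib.
  case: (pairwise_sep (good_sorted gc) WL VL ne) => h.
    by apply: (asym _ _ ib); apply: beforeP h bW iV'.
  by apply: (asym _ _ aj); apply: beforeP h jV aW.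
move: UP; rewrite inE mem_cat => /orP[UI|UL]; last exact: (ext U i j').
have [W WL [x [y [xW yW h]]]] := good_nested gc UI.
have [xi _] := h _ iU; have [_ jy] := h _ jU'.
have xj := chi_lt_trans xi ij; have iy := chi_lt_trans ij' jy.
have [WV|ne] := eqVneq W V; last exact: (ext W x y).
rewrite WV in xW; have [e|ne] := eqVneq x j; first by rewrite e chi_lt_irr in xj.
by apply: asym xj _; apply: chi_min_lt mj xW ne.
Qed.

End InteriorBlocks.

(** * Expansion of a word of operators over diagrams *)

Section FockExpansion.
Variables (C : fieldType) (K : eqType) (L : choiceType).
Variables (col : L -> K) (sd : L -> side) (kap : seq L -> C).
Local Notation F := {malg C[blocks L]}.

Definition act (a : L) : F -> F :=
  if sd a is Left then act_l col kap a else act_r col kap a.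

Fact act_is_linear a : linear (act a).
Proof. by rewrite /act; case: (sd a) => c y z; rewrite linearP. Qed.
HB.instance Definition _ a :=
  GRing.isLinear.Build C F F *:%R (act a) (act_is_linear a).

Definition fock (w : seq L) : F := foldr act 1 w.

Variables (n : nat) (x : 'I_n -> L).
Local Notation T := 'I_n.
Local Notation wb := (word_block x).
Local Notation chi := (fun i => sd (x i)).

(** Interior blocks can no longer be extended and are scalars; each exterior block is still a
    superposition of closed and open, in its place on the line. *)
Definition weight (c : diagram T) : F :=
  (\prod_(V <- c.1) kap (wb V)) *: \prod_(V <- c.2) eps kap (wb V).

Lemma flip_prod_eps (s : seq {set T}) :
  flip (\prod_(V <- s) eps kap (wb V)) = \prod_(V <- rev s) eps kap (wb V).
Proof.
elim: s => [|V s IH]; first by rewrite !big_nil -blist_nil flip_blist.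
by rewrite big_cons flipM IH rev_cons -cats1 big_cat big_seq1 flip_eps.
Qed.

Lemma flip_weight c : flip (weight c) = weight (mirror c).
Proof. by rewrite /weight linearZ /= flip_prod_eps. Qed.

Lemma word_block_cons (m : T) (V : {set T}) : (forall i, i \in V -> (m < i)%N) ->
  wb (m |: V) = x m :: wb V.
Proof.
move=> h; rewrite /word_block; suff -> : enum (m |: V) = m :: enum V by [].
have st : transitive (fun i j : T => (i < j)%N) by move=> ? ? ?; apply: ltn_trans.
have so (W : {set T}) : sorted (fun i j : T => (i < j)%N) (enum W).
  rewrite {1}/enum_mem; apply: sorted_filter => //.
  by have := iota_ltn_sorted 0 n; rewrite -val_enum_ord sorted_map enumT.
apply: (irr_sorted_eq st) => //; first by move=> i; rewrite /= ltnn.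
  rewrite /= path_min_sorted //; apply/allP => i; rewrite mem_enum; exact: h.
by move=> i; rewrite inE !mem_enum !inE.
Qed.

(** By [join_epsM], a letter that passes the first exterior block closes it, which moves it to the
    interior list with factor [kap]: this is the recursion of [absorb]. *)
Lemma join_absorb (m : T) (I J : seq {set T}) :
  (forall V, V \in J -> wb (m |: V) = x m :: wb V) ->
  (\prod_(V <- I) kap (wb V)) *: join col kap (x m) (\prod_(V <- J) eps kap (wb V)) =
  \sum_(c <- absorb m (joinable col x m) I J) weight c.
Proof.
elim: J I => [|V J IH] I h; first by rewrite !big_nil join1 scaler0.
have hJ U : U \in J -> wb (m |: U) = x m :: wb U by move=> UJ; apply: h; rewrite inE UJ orbT.
rewrite big_cons join_epsM scalerDr scalerA [_ * kap _]mulrC /= big_cat /=.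
rewrite -(IH (V :: I)) // big_cons [LHS]addrC /joinable.
case: ifP => _; last by rewrite big_nil scaler0.
by rewrite big_seq1 /weight /= big_cons h ?mem_head.
Qed.

Lemma act_l_weight (m : T) (c : diagram T) :
  (forall V, V \in c.2 -> wb (m |: V) = x m :: wb V) ->
  act_l col kap (x m) (weight c) =
  \sum_(c' <- insert_min m (joinable col x m) c) weight c'.
Proof.
have e : wb [set m] = [:: x m] by rewrite /word_block enum_set1.
move=> h; rewrite /insert_min big_cons -join_absorb // /weight linearZ /=.
by rewrite /act_l scalerDr big_cons e.
Qed.

Lemma act_weight (m : T) (c : diagram T) :
  (forall V, V \in c.2 -> wb (m |: V) = x m :: wb V) ->
  act (x m) (weight c) = \sum_(c' <- insert col sd x m c) weight c'.
Proof.
move=> h; rewrite /act /insert; case: (sd (x m)); first exact: act_l_weight.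
rewrite /act_r flip_weight act_l_weight => [|V]; last by rewrite mem_rev; apply: h.
by rewrite big_map linear_sum; apply: eq_bigr => d _ /=; rewrite flip_weight.
Qed.

Lemma fock_diagrams (s : seq T) : sorted (@increasing n) s ->
  fock (map x s) = \sum_(c <- diagrams col sd x s) weight c.
Proof.
elim: s => [|m s IH] so.
  by rewrite big_seq1 /weight !big_nil scale1r.
have so' := path_sorted so.
rewrite /= IH // linear_sum /= big_flatten big_map /= [LHS]big_seq [RHS]big_seq.
apply: eq_bigr => c /(diagrams_good so') g; apply: act_weight => V VL.
apply: word_block_cons => i iV; apply: (path_increasing so).
apply: subsetP (partitionS (good_partition g) _) _ iV.
by rewrite inE mem_cat VL orbT.
Qed.

Definition colour_partition (P : {set {set T}}) : bool :=
  [forall V in P, forall i in V, forall j in V, col (x i) == col (x j)].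

Lemma colour_partitionP (P : {set {set T}}) :
  reflect (forall V, V \in P -> one_colour col x V) (colour_partition P).
Proof.
apply: (iffP forall_inP) => h V VP.
  by move=> i j iV jV; have /forall_inP/(_ _ iV)/forall_inP/(_ _ jV)/eqP := h V VP.
by apply/forall_inP => i iV; apply/forall_inP => j jV; apply/eqP; apply: h VP _ _ iV jV.
Qed.

Lemma noncrossingP (P : {set {set T}}) : reflect (noncrossing_for (chi_lt chi) P) (noncrossing chi P).
Proof.
apply: (iffP forall_inP) => [h V U i j k l VP UP ne iV jU kV lU ij jk kl|h V VP].
  have /forall_inP/(_ U UP)/implyP/(_ ne)/forall_inP/(_ i iV) := h V VP.
  move=> /forall_inP/(_ j jU)/forall_inP/(_ k kV)/forall_inP/(_ l lU).
  by rewrite ij jk kl.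
apply/forall_inP => U UP; apply/implyP => ne; apply/forall_inP => i iV.
apply/forall_inP => j jU; apply/forall_inP => k kV; apply/forall_inP => l lU.
by apply/negP => /and3P[ij jk kl]; apply: (h V U i j k l).
Qed.

Lemma sum_diagrams (V : nmodType) (f : {set {set T}} -> V) :
  \sum_(P in BNC chi | colour_partition P) f P =
  \sum_(c <- diagrams col sd x (enum T)) f (blocks_of c).
Proof.
have so : sorted (@increasing n) (enum T).
  by have := iota_ltn_sorted 0 n; rewrite -val_enum_ord sorted_map.
have DT : [set i in enum T] = [set: T] by apply/setP => i; rewrite !inE mem_enum.
rewrite -(big_map (@blocks_of T) xpredT) -big_enum_cond /= -big_filter.
apply: perm_big; apply: uniq_perm; first by rewrite filter_uniq ?enum_uniq.
  exact: diagrams_uniq.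
move=> P; rewrite mem_filter mem_enum inE; apply/idP/mapP.
  case/and3P => /colour_partitionP ok1 hP /noncrossingP nc.
  by have [|c hc <-] := diagrams_onto so _ nc ok1; [rewrite DT|exists c].
case=> c /(diagrams_good so) g ->; apply/and3P; split.
- by apply/colour_partitionP; apply: good_ok g.
- by have := good_partition g; rewrite DT.
- by apply/noncrossingP; apply: good_nc g.
Qed.

(** The character [theta] is multiplicative and sends each exterior factor of [weight] to
    [kap + th]; the two lists of a diagram are its interior and its exterior blocks. *)
Theorem theta_fock (th : seq L -> C) :
  theta th (fock (map x (enum T))) =
  \sum_(P in BNC chi | colour_partition P)
    (\prod_(V in P | interior_block chi P V) kap (wb V)) *
    (\prod_(V in P | ~~ interior_block chi P V) (kap (wb V) + th (wb V))).
Proof.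
have so : sorted (@increasing n) (enum T).
  by have := iota_ltn_sorted 0 n; rewrite -val_enum_ord sorted_map.
rewrite fock_diagrams // linear_sum sum_diagrams [LHS]big_seq [RHS]big_seq.
apply: eq_bigr => c /(diagrams_good so) g; rewrite /weight linearZ /=.
rewrite rmorph_prod.
have prodE (Q : pred {set T}) (f : {set T} -> C) :
    \prod_(V in blocks_of c | Q V) f V = \prod_(V <- c.1 ++ c.2 | Q V) f V.
  rewrite -big_enum_cond -big_filter -[RHS]big_filter; apply: perm_big.
  apply: uniq_perm; try apply: filter_uniq; rewrite ?(good_uniq g) //.
    exact: enum_uniq.
  by move=> V; rewrite mem_filter [RHS]mem_filter mem_enum inE.
rewrite !prodE !big_cat /=; congr (_ * _).
  rewrite [X in _ * X]big1_seq ?mulr1; last first.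
    by move=> V /andP[hV /(exterior_in g)]; rewrite hV.
  rewrite [LHS]big_seq [RHS]big_seq_cond; apply: eq_bigl => V.
  by case VI: (V \in c.1); rewrite // (interior_in g).
rewrite [X in X * _]big1_seq ?mul1r; last first.
  by move=> V /andP[hV /(interior_in g)]; rewrite (negbTE hV).
rewrite [LHS]big_seq [RHS]big_seq_cond; apply: eq_big => V.
  by case VL: (V \in c.2); rewrite // (exterior_in g).
by rewrite theta_eps.
Qed.

End FockExpansion.

(** * Cumulants as functions of words *)

Section CumulantsOfWords.
Variables (C : fieldType) (A : algType C) (K : choiceType).
Local Notation L := (fp_letter A K).
Implicit Types (F G : multi_functional A) (w : seq L).

Definition colour (t : L) : K := t.1.1.
Definition letter_side (t : L) : side := t.1.2.
Definition letter_val (t : L) : A := t.2.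

Definition on_word F w : C :=
  F (size w) (fun i => letter_side (tnth (in_tuple w) i))
    (fun i => letter_val (tnth (in_tuple w) i)).

Lemma multi_functional_cast F m n (e : m = n) chi a chi' a' :
  (forall i, chi i = chi' (cast_ord e i)) -> (forall i, a i = a' (cast_ord e i)) ->
  F m chi a = F n chi' a'.
Proof.
case: _ / e chi' a' => chi' a' h h'.
by congr (F _ _ _); apply/funext => i; rewrite ?h ?h' cast_ord_id.
Qed.

Section Word.
Variables (n : nat) (x : 'I_n -> L).
Local Notation chi := (fun i => letter_side (x i)).
Local Notation a := (fun i => letter_val (x i)).

Lemma on_word_block F (V : {set 'I_n}) :
  on_word F (word_block x V) = F #|V| (Defs.restrict V chi) (Defs.restrict V a).
Proof.
have e : size (word_block x V) = #|V| by rewrite size_map -cardE.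
have h i : tnth (in_tuple (word_block x V)) i = x (enum_val (cast_ord e i)).
  (* A default value for [nth]; the index [i] shows that ['I_n] is inhabited. *)
  have i0 : 'I_n by have := enum_val (cast_ord e i).
  by rewrite (tnth_nth (x i0)) /= (nth_map i0) -?cardE ?ltn_ord -?e // (enum_val_nth i0).
by apply: (@multi_functional_cast _ _ _ e) => i; rewrite h.
Qed.

(** Makes the expansion for [psi] the special case of the one for [phi] in which both kinds of
    cumulants agree. *)
Lemma kappa_term_self F (P : {set {set 'I_n}}) :
  kappa_term F chi a P = ckappa_term F F chi a P.
Proof. by rewrite /kappa_term (bigID (interior_block chi P)). Qed.

Lemma theta_fock_ckappa F G :
  theta (fun w => on_word G w - on_word F w)
    (fock colour letter_side (on_word F) (map x (enum 'I_n))) =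
  \sum_(P in BNC chi | colour_partition colour x P) ckappa_term F G chi a P.
Proof.
rewrite theta_fock; apply: eq_bigr => P _.
by congr (_ * _); apply: eq_bigr => V _; rewrite ?subrKC !on_word_block.
Qed.

Lemma vac_fock_kappa F :
  vac (fock colour letter_side (on_word F) (map x (enum 'I_n))) =
  \sum_(P in BNC chi | colour_partition colour x P) kappa_term F chi a P.
Proof.
rewrite -theta0 theta_fock; apply: eq_bigr => P _; rewrite kappa_term_self.
by congr (_ * _); apply: eq_bigr => V _; rewrite ?addr0 !on_word_block.
Qed.

End Word.
End CumulantsOfWords.

(** * The c-free product and the Fock space *)

Section CFreeEvaluation.
Variables (C : fieldType) (K : choiceType) (X : K -> two_state_space C).

Lemma cfree_phi_tens (s : seq (letter X)) : alternating s ->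
  ts_phi (cfree X) (tens s) = \prod_(t <- s) ts_phi (X (tag t)) (tagged t).
Proof. by move=> a; rewrite -[s]/(val (Sub s a : word X)) tensE; exact: cfree_phiE. Qed.

Lemma cfree_psi_tens (s : seq (letter X)) : alternating s ->
  ts_psi (tens s : cfree X) = (s == [::])%:R.
Proof.
move=> a; have [->|ne] := eqVneq s [::]; first exact: ts_psi_xi.
apply/eqP; rewrite ts_psi_ker; apply/asboolP; apply: lspan_gen.
by exists (Sub s a); rewrite -tensE.
Qed.

Lemma ts_phi_proj (Y : two_state_space C) (x : Y) :
  ts_psi x + ts_phi Y (ts_proj x) = ts_phi Y x.
Proof. by rewrite [in RHS](ts_projE x) linearP /= ts_phi_xi mulr1. Qed.

Lemma ts_psi_proj (Y : two_state_space C) (x : Y) : ts_psi (ts_proj x) = 0.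
Proof. by apply/eqP; rewrite ts_psi_ker ts_proj_circ. Qed.

Lemma Vmap_xi k (x : X k) :
  ts_phi (cfree X) (Vmap x [::]) = ts_phi (X k) x /\ ts_psi (Vmap x [::]) = ts_psi x.
Proof.
have a1 : alternating [:: lett (ts_proj x)] by rewrite /alternating /= ts_proj_circ.
split; rewrite linearP /=.
  rewrite !cfree_phi_tens // big_nil big_seq1 mulr1; exact: ts_phi_proj.
by rewrite !cfree_psi_tens //= addr0; exact: mulr1.
Qed.

End CFreeEvaluation.

(** * Transfer from one-coloured words to all words *)

Section Coupling.
Variables (C : fieldType) (A : algType C) (K : choiceType).
Variables (S : K -> side -> {pred A}) (X : K -> two_state_space C).
Variable lr : forall k, side -> A -> {linear X k -> X k}.
Local Notation L := (fp_letter A K).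
Local Notation F := {malg C[blocks L]}.

Definition admissible (w : seq L) : bool :=
  all (fun t => t.2 \in S t.1.1 t.1.2) w.

Definition coloured (k : K) (w : seq L) : bool := all (fun t => colour t == k) w.

Definition local_word k (w : seq L) : X k :=
  foldr (fun t y => lr k t.1.2 t.2 y) (ts_xi (X k)) w.

Variables (kap th : seq L -> C).
Local Notation kact := (act (@colour C A K) (@letter_side C A K) kap).
Local Notation kfock := (fock (@colour C A K) (@letter_side C A K) kap).

Hypothesis local_psi : forall k w, admissible w -> coloured k w ->
  ts_psi (local_word k w) = vac (kfock w).
Hypothesis local_phi : forall k w, admissible w -> coloured k w ->
  ts_phi (X k) (local_word k w) = theta th (kfock w).

(** Pairs of a vector of [X k] and a vector of the Fock space obtained from the
    state-vectors by the same operators. *)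
Definition coupled k : X k * F -> Prop :=
  lspan (fun p => exists w, [/\ admissible w, coloured k w &
                                p = (local_word k w, kfock w)]).

Lemma coupled_xi k : coupled (ts_xi (X k), 1).
Proof. by apply: lspan_gen; exists [::]. Qed.

Lemma coupled_psi k (p : X k * F) : coupled p -> ts_psi p.1 = vac p.2.
Proof.
elim=> [|c u v [w [h1 h2 ->]] _ IH]; first by rewrite !linear0.
by rewrite !linearP /= IH local_psi.
Qed.

Lemma coupled_phi k (p : X k * F) : coupled p -> ts_phi (X k) p.1 = theta th p.2.
Proof.
elim=> [|c u v [w [h1 h2 ->]] _ IH]; first by rewrite !linear0.
by rewrite !linearP /= IH local_phi.
Qed.

Lemma coupled_act k (p : X k * F) (t : L) : t.2 \in S t.1.1 t.1.2 ->
  colour t = k -> coupled p -> coupled (lr k t.1.2 t.2 p.1, kact t p.2).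
Proof.
move=> ht tk; elim=> [|c u v [w [h1 h2 ->]] _ IH].
  by rewrite !linear0; exact: lspan0.
rewrite !linearP /=.
apply: (@lspanP _ _ _ c (lr k t.1.2 t.2 (local_word k w), kact t (kfock w)) _ _ IH).
by exists (t :: w); split=> //=; [apply/andP|apply/andP; rewrite tk].
Qed.

Lemma coupled_monochromatic k (p : X k * F) :
  coupled p -> monochromatic (@colour C A K) k p.2.
Proof.
elim=> [|c u v [w [_ h ->]] _ IH]; first exact: lspan0.
apply: lspanD IH; apply: lspanZ => {u v}.
elim: w h => [|t w IH] /=; first by move=> _; exact: (@monochromatic_blist _ _ _ _ _ [::]).
case/andP=> /eqP tk /IH; rewrite /act -tk; case: (letter_side t).
  exact: monochromatic_act_l.
exact: monochromatic_act_r.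
Qed.

(** Both components are centred by the same scalar, because [ts_psi] and [vac] agree on coupled
    pairs. *)
Lemma coupled_proj k (p : X k * F) :
  coupled p -> coupled (ts_proj p.1, p.2 - vac p.2 *: 1).
Proof.
move=> h; have -> : (ts_proj p.1, p.2 - vac p.2 *: 1) = p - vac p.2 *: (ts_xi (X k), 1).
  by rewrite -(coupled_psi h); case: (p).
by apply: lspanB => //; apply: lspanZ; apply: coupled_xi.
Qed.

Definition link (e : letter X * F) : bool :=
  `[< coupled (tagged e.1, e.2) /\ ts_psi (tagged e.1) = 0 >].

Definition chain (g : seq (letter X * F)) : bool :=
  all link g && sorted (fun i j => i != j) [seq tag e.1 | e <- g].

Definition chain_tens (g : seq (letter X * F)) : cfree X := tens (map fst g).
Definition chain_prod (g : seq (letter X * F)) : F := \prod_(e <- g) e.2.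

(** A span of pairs rather than a map: nothing has to be well defined, since only functionals of the
    two components are compared. *)
Definition coupled_cfree : cfree X * F -> Prop :=
  lspan (fun p => exists2 g, chain g & p = (chain_tens g, chain_prod g)).

Lemma chain_alternating g : chain g -> alternating (map fst g).
Proof.
case/andP=> hl hs; apply/andP; split; last by rewrite -map_comp.
rewrite all_map; apply: sub_all hl => e /asboolP[_ h] /=.
by rewrite -ts_psi_ker h.
Qed.

Lemma coupled_cfree_chain g : chain g -> coupled_cfree (chain_tens g, chain_prod g).
Proof. by move=> h; apply: lspan_gen; exists g. Qed.

Lemma link_proj k (p : X k * F) :
  coupled p -> link (lett (ts_proj p.1), p.2 - vac p.2 *: 1).
Proof.
by move=> h; apply/asboolP; split; [exact: coupled_proj|exact: ts_psi_proj].
Qed.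

(** Splitting [p.1] into a multiple of the state-vector and a centred part, and [p.2] by the same
    scalar, leaves the chain [g] and a chain with one more factor. *)
Lemma coupled_Vmap k (p : X k * F) g : coupled p -> chain g ->
  (if g is e :: _ then tag e.1 != k else true) ->
  coupled_cfree (Vmap p.1 (map fst g), p.2 * chain_prod g).
Proof.
move=> hp hg hk; pose g' := (lett (ts_proj p.1), p.2 - vac p.2 *: 1) :: g.
have hg' : chain g'.
  case/andP: hg => h1 h2; apply/andP; split; first by rewrite /= link_proj.
  by rewrite /=; case: g hk h2 {h1 g'} => //= e g; rewrite eq_sym => -> ->.
have -> : (Vmap p.1 (map fst g), p.2 * chain_prod g) =
    vac p.2 *: (chain_tens g, chain_prod g) + (chain_tens g', chain_prod g').
  rewrite -(coupled_psi hp) /Vmap; congr (_, _).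
  by rewrite /chain_prod big_cons /= mulrBl -scalerAl mul1r (coupled_psi hp) addrC subrK.
by apply: lspanD; [apply: lspanZ|]; apply: coupled_cfree_chain.
Qed.

Lemma coupled_Wmap k (p : X k * F) g : coupled p -> chain g ->
  (if rev g is e :: _ then tag e.1 != k else true) ->
  coupled_cfree (Wmap (map fst g) p.1, chain_prod g * p.2).
Proof.
move=> hp hg hk; pose g' := rcons g (lett (ts_proj p.1), p.2 - vac p.2 *: 1).
have hg' : chain g'.
  case/andP: hg => h1 h2; apply/andP; split; first by rewrite all_rcons link_proj.
  rewrite map_rcons; case/lastP: g hk h2 {h1 g'} => // g e.
  rewrite rev_rcons map_rcons => h; case: (map _ g) => [|i s] /=; first by rewrite h.
  by rewrite [in X in _ -> X]rcons_path last_rcons => ->.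
have -> : (Wmap (map fst g) p.1, chain_prod g * p.2) =
    vac p.2 *: (chain_tens g, chain_prod g) + (chain_tens g', chain_prod g').
  rewrite -(coupled_psi hp) /Wmap /chain_tens map_rcons; congr (_, _).
  rewrite /chain_prod /g' /= -cats1 big_cat big_seq1 /= mulrBr.
  by rewrite -[in RHS]malg_scalerAr mulr1 (coupled_psi hp) addrC subrK.
by apply: lspanD; [apply: lspanZ|]; apply: coupled_cfree_chain.
Qed.

(** If the first factor has the colour of [t], both operators act on it alone, since its partner is
    centred. Otherwise, or on the empty chain, both create a new first factor from the
    state-vectors, the one on the Fock side being [act_l t 1]. *)
Lemma coupled_lambda (t : L) (p : cfree X * F) : t.2 \in S t.1.1 t.1.2 ->
  letter_side t = Left -> coupled_cfree p ->
  coupled_cfree (lambda (lr t.1.1 Left t.2) p.1, act_l (@colour C A K) kap t p.2).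
Proof.
move=> ht tl; elim=> [|c u v [g hg ->] _ IH].
  by rewrite !linear0; exact: lspan0.
rewrite !linearP /=.
apply: (@lspanD _ _ _ (c *: (lambda (lr t.1.1 Left t.2) (chain_tens g),
  act_l (@colour C A K) kap t (chain_prod g))) _ _ IH).
apply: lspanZ => {IH u v c}; set k := t.1.1.
have hact q : coupled q -> coupled (lr k Left t.2 q.1, act_l (@colour C A K) kap t q.2).
  by move=> hq; have := coupled_act ht (erefl k) hq; rewrite /act tl -/(letter_side t) tl.
rewrite lambda_tens ?chain_alternating //.
case: g hg => [|[[k1 x1] y1] g] hg.
  have := coupled_Vmap (hact _ (coupled_xi k)) hg isT.
  by rewrite /chain_prod big_nil mulr1.
have [/= /andP[/asboolP[/= cx1 px1] hl] hs] := andP hg.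
have vy1 : vac y1 = 0 by rewrite -(coupled_psi cx1).
have hg' : chain g by apply/andP; split=> //; apply: path_sorted hs.
have e1 : chain_prod ((existT (fun k => X k : Type) k1 x1, y1) :: g) = y1 * chain_prod g.
  by rewrite /chain_prod big_cons.
have [ek|ne] := eqVneq k1 k.
  case: _ / (esym ek) x1 cx1 px1 hg hs e1 => x1 cx1 px1 hg hs e1.
  rewrite /= -/(lett x1) untag_lett e1 act_l_mul //.
  apply: (coupled_Vmap (hact _ cx1)) => //.
  by case: g hs {hl hg hg' e1} => //= e g /andP[]; rewrite eq_sym.
rewrite /= untag_dflt // e1 act_l_mul // (act_l_other _ (coupled_monochromatic cx1)).
  rewrite -(act_l1 (@colour C A K)) -mulrA -e1.
  exact: (coupled_Vmap (hact _ (coupled_xi k)) hg).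
by rewrite eq_sym.
Qed.

Lemma coupled_rho (t : L) (p : cfree X * F) : t.2 \in S t.1.1 t.1.2 ->
  letter_side t = Right -> coupled_cfree p ->
  coupled_cfree (rho (lr t.1.1 Right t.2) p.1, act_r (@colour C A K) kap t p.2).
Proof.
move=> ht tr; elim=> [|c u v [g hg ->] _ IH].
  by rewrite !linear0; exact: lspan0.
rewrite !linearP /=.
apply: (@lspanD _ _ _ (c *: (rho (lr t.1.1 Right t.2) (chain_tens g),
  act_r (@colour C A K) kap t (chain_prod g))) _ _ IH).
apply: lspanZ => {IH u v c}; set k := t.1.1.
have hact q : coupled q -> coupled (lr k Right t.2 q.1, act_r (@colour C A K) kap t q.2).
  by move=> hq; have := coupled_act ht (erefl k) hq; rewrite /act tr -/(letter_side t) tr.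
rewrite rho_tens ?chain_alternating //.
case/lastP: g hg => [|g [[k1 x1] y1]] hg.
  have := coupled_Wmap (hact _ (coupled_xi k)) hg isT.
  by rewrite /chain_prod big_nil mul1r.
have [] := andP hg; rewrite all_rcons map_rcons => /andP[/asboolP[/= cx1 px1] hl] hs.
have vy1 : vac y1 = 0 by rewrite -(coupled_psi cx1).
have hg' : chain g.
  apply/andP; split=> //; case: (map _ g) hs => //= i s.
  by rewrite rcons_path => /andP[].
have e1 : chain_prod (rcons g (existT (fun k => X k : Type) k1 x1, y1)) = chain_prod g * y1.
  by rewrite /chain_prod -cats1 big_cat big_seq1.
have [ek|ne] := eqVneq k1 k.
  case: _ / (esym ek) x1 cx1 px1 hg hs e1 => x1 cx1 px1 hg hs e1.
  rewrite map_rcons rho_word_rcons /= -/(lett x1) untag_lett e1 act_r_mul //.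
  apply: (coupled_Wmap (hact _ cx1)) => //.
  case/lastP: g hs {hl hg hg' e1} => // g e; rewrite rev_rcons map_rcons.
  case: (map _ g) => [|i s] /=; first by rewrite andbT.
  by rewrite rcons_path last_rcons => /andP[].
rewrite map_rcons rho_word_rcons /= untag_dflt // e1 act_r_mul //.
rewrite (act_r_other _ (coupled_monochromatic cx1)); last by rewrite eq_sym.
rewrite -(act_r1 (@colour C A K)) mulrA -e1.
by have := coupled_Wmap (hact _ (coupled_xi k)) hg; rewrite rev_rcons map_rcons; apply.
Qed.

Lemma coupled_word (w : seq L) : admissible w ->
  coupled_cfree (op_word (lambda_rho lr) w (ts_xi (cfree X)), kfock w).
Proof.
elim: w => [_|t w IH /= /andP[ht /IH h]].
  have := coupled_cfree_chain (g := [::]) isT.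
  by rewrite /chain_prod big_nil.
rewrite /act /lambda_rho -/(letter_side t); case e: (letter_side t).
  exact: (coupled_lambda ht e h).
exact: (coupled_rho ht e h).
Qed.

(** Only the empty chain contributes on either side: [vac] is multiplicative, being [theta] at [0],
    and vanishes on the centred first factor. *)
Theorem cfree_psi_fock (w : seq L) : admissible w ->
  ts_psi (op_word (lambda_rho lr) w (ts_xi (cfree X))) = vac (kfock w).
Proof.
move/coupled_word; set p := (_, _); rewrite -[LHS]/(ts_psi p.1) -[RHS]/(vac p.2).
elim=> [|c u v [g hg ->] _ IH]; first by rewrite !linear0.
rewrite !linearP /= IH cfree_psi_tens ?chain_alternating //.
congr (_ * _ + _); rewrite -theta0 /chain_prod rmorph_prod /=; case: g hg => [|e g] /andP[/= hl _]; first by rewrite big_nil.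
have [/asboolP[h0 h1] _] := andP hl.
by rewrite big_cons theta0 -(coupled_psi h0) h1 mul0r.
Qed.

(** Both functionals are multiplicative along a chain, and [coupled_phi] compares them factor by
    factor. *)
Theorem cfree_phi_fock (w : seq L) : admissible w ->
  ts_phi (cfree X) (op_word (lambda_rho lr) w (ts_xi (cfree X))) = theta th (kfock w).
Proof.
move/coupled_word; set p := (_, _).
rewrite -[X in ts_phi _ X]/(p.1) -[RHS]/(theta th p.2).
elim=> [|c u v [g hg ->] _ IH]; first by rewrite !linear0.
rewrite !linearP /= IH cfree_phi_tens ?chain_alternating //.
congr (_ * _ + _); rewrite /chain_prod rmorph_prod /= big_map big_seq [RHS]big_seq; apply: eq_bigr => e eg.
by have /andP[/allP/(_ _ eg)/asboolP[h _] _] := hg; exact: coupled_phi h.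
Qed.

End Coupling.

Lemma scalerCA (C : fieldType) (V : lmodType C) (a b : C) (v : V) :
  a *: (b *: v) = b *: (a *: v).
Proof. by rewrite !scalerA mulrC. Qed.

(** * The operators [lambda] and [rho] as representations *)

Section Representations.
Variables (C : fieldType) (K : choiceType) (X : K -> two_state_space C).

Lemma tens0 u v k : tens (u ++ lett (0 : X k) :: v) = 0.
Proof.
have := tens_multilinear (X := X) u v (-1) (ts_circ0 (X k)) (ts_circ0 (X k)).
by rewrite scaler0 addr0 scaleN1r addNr.
Qed.

Lemma ts_proj_id (Y : two_state_space C) (y : Y) : y \in ts_circ Y -> ts_proj y = y.
Proof. by rewrite -ts_psi_ker /ts_proj => /eqP ->; rewrite scale0r subr0. Qed.

Lemma ts_proj_xi (Y : two_state_space C) : ts_proj (ts_xi Y) = 0.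
Proof. by rewrite /ts_proj ts_psi_xi scale1r subrr. Qed.

Lemma Vmap_vac k s : Vmap (ts_xi (X k)) s = tens s.
Proof. by rewrite /Vmap ts_psi_xi ts_proj_xi scale1r (tens0 [::]) addr0. Qed.

Lemma Wmap_vac k s : Wmap s (ts_xi (X k)) = tens s.
Proof. by rewrite /Wmap ts_psi_xi ts_proj_xi scale1r -cats1 tens0 addr0. Qed.

Lemma Vmap_circ k (x : X k) s : x \in ts_circ (X k) -> Vmap x s = tens (lett x :: s).
Proof.
move=> xc; rewrite /Vmap ts_proj_id //.
by move: xc; rewrite -ts_psi_ker => /eqP ->; rewrite scale0r add0r.
Qed.

Lemma Wmap_circ k (x : X k) s : x \in ts_circ (X k) -> Wmap s x = tens (rcons s (lett x)).
Proof.
move=> xc; rewrite /Wmap ts_proj_id //.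
by move: xc; rewrite -ts_psi_ker => /eqP ->; rewrite scale0r add0r.
Qed.

Lemma cfree_ext (f g : cfree X -> cfree X) : linear f -> linear g ->
  (forall s, alternating s -> f (tens s) = g (tens s)) -> f =1 g.
Proof.
move=> lf lg fg x.
have zero h : linear h -> h (0 : cfree X) = 0 :> cfree X.
  by move=> lh; have := lh (-1) 0 0; rewrite scaler0 addr0 scaleN1r addNr.
elim: (presented_span (x : presented _)) => [|c y z [w ->] _ IH]; first by rewrite !zero.
by rewrite lf lg IH -[gen _ w]/(elt w) -tensE fg ?(valP w).
Qed.

(** The identification [Vmap] is onto: an alternating word splits off its first letter if that has
    index [k], and otherwise the state-vector of [X k]. Identities then need checking only where
    [lambda] is [T] tensored with the identity. *)
Lemma cfree_ext_l k (f g : cfree X -> cfree X) : linear f -> linear g ->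
  (forall (x : X k) s, alternating s -> (if s is t :: _ then tag t != k else true) ->
     f (Vmap x s) = g (Vmap x s)) -> f =1 g.
Proof.
move=> lf lg fg; apply: cfree_ext => // s a.
case: s a => [|[k1 x1] s] a; first by rewrite -(Vmap_vac k) fg.
have [ek|ne] := eqVneq k1 k; last by rewrite -(Vmap_vac k) fg.
case: _ / ek f g lf lg fg => f g lf lg fg.
have hx : x1 \in ts_circ (X k1) := @alternating_mem _ _ _ [::] s k1 x1 a.
rewrite -[existT _ k1 x1]/(lett x1) -Vmap_circ // fg //.
  by case/andP: a => /= /andP[_ h1] h2; apply/andP; split; last exact: path_sorted h2.
by case/andP: a => _; case: (s) => //= t s' /andP[]; rewrite eq_sym.
Qed.

Lemma cfree_ext_r k (f g : cfree X -> cfree X) : linear f -> linear g ->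
  (forall (x : X k) s, alternating s -> (if rev s is t :: _ then tag t != k else true) ->
     f (Wmap s x) = g (Wmap s x)) -> f =1 g.
Proof.
move=> lf lg fg; apply: cfree_ext => // s a.
case/lastP: s a => [|s [k1 x1]] a; first by rewrite -(Wmap_vac k) fg.
have [ek|ne] := eqVneq k1 k; last by rewrite -(Wmap_vac k) fg ?rev_rcons.
case: _ / ek f g lf lg fg => f g lf lg fg.
have hx : x1 \in ts_circ (X k1).
  by apply: (@alternating_mem _ _ _ s [::] k1 x1); rewrite cats1.
rewrite -[existT _ k1 x1]/(lett x1) -Wmap_circ // fg //.
  case/andP: a; rewrite all_rcons map_rcons => /andP[_ h1] h2; apply/andP; split=> //.
  by case: (map _ s) h2 => //= i s'; rewrite rcons_path => /andP[].
case/andP: a => _; case/lastP: (s) => // s' t; rewrite rev_rcons !map_rcons.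
case: (map _ s') => [|i s''] /=; first by rewrite andbT.
by rewrite rcons_path last_rcons => /andP[].
Qed.

Variables (A : algType C) (S : K -> side -> {pred A}).
Variable lr : forall k, side -> A -> {linear X k -> X k}.

Lemma lambda_rho_hom : (forall k s, unital_hom (S k s) (lr k s)) ->
  forall k s, unital_hom (S k s) (lambda_rho lr k s).
Proof.
move=> hlr k s; have [h1 hM hD] := hlr k s.
case: s h1 hM hD => h1 hM hD; split=> [|a b aS bS|c a b aS bS].
- by apply: (cfree_ext_l (k := k)) => [|//|x s ha hs]; [exact: linearP|rewrite /= lambda_V // h1].
- apply: (cfree_ext_l (k := k)) => [|c u v|x s ha hs]; first exact: linearP.
    by rewrite !linearP.
  by rewrite /= !lambda_V // hM.
- apply: (cfree_ext_l (k := k)) => [|d u v|x s ha hs]; first exact: linearP.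
    by rewrite !linearP /= [LHS]addrACA [d *: (c *: _)]scalerCA.
  by rewrite /= !lambda_V // hD // Vmap_linear.
- by apply: (cfree_ext_r (k := k)) => [|//|x s ha hs]; [exact: linearP|rewrite /= rho_W // h1].
- apply: (cfree_ext_r (k := k)) => [|c u v|x s ha hs]; first exact: linearP.
    by rewrite !linearP.
  by rewrite /= !rho_W // hM.
- apply: (cfree_ext_r (k := k)) => [|d u v|x s ha hs]; first exact: linearP.
    by rewrite !linearP /= [LHS]addrACA [d *: (c *: _)]scalerCA.
  by rewrite /= !rho_W // hD // Wmap_linear.
Qed.

Lemma op_word_coloured k (w : seq (fp_letter A K)) : coloured k w ->
  op_word (lambda_rho lr) w (ts_xi (cfree X)) = Vmap (local_word lr k w) [::].
Proof.
elim: w => [|[[k1 s] a] w IH] /=; first by rewrite Vmap_vac.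
case/andP => /eqP; rewrite /colour /= => ek /IH ->.
case: _ / (esym ek) {IH}; case: s; first by rewrite [LHS]lambda_V.
(* On the empty word [Wmap] and [Vmap] are convertible, so left and right operators of one colour
   act on the same copy of [X k]. *)
exact: (@rho_W _ _ _ _ _ _ [::]).
Qed.

(** One direction evaluates at the generators. Conversely, both pairs of functionals are computed as
    the same linear combination of values at words, over the support of a representative. *)
Lemma op_pair_distributionP (phi psi : {scalar A}) :
  (forall k s, unital_hom (S k s) (lr k s)) ->
  pair_distribution S phi psi = op_pair_distribution S (lambda_rho lr) <->
  forall w, admissible S w ->
    phi (\prod_(t <- w) t.2) =
      ts_phi (cfree X) (op_word (lambda_rho lr) w (ts_xi (cfree X))) /\
    psi (\prod_(t <- w) t.2) =
      ts_psi (op_word (lambda_rho lr) w (ts_xi (cfree X))).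
Proof.
move=> hlr; have hop := lambda_rho_hom hlr; split=> [[ephi epsi] w wS|h].
  pose w' : fp_word S := Sub w wS.
  have := congr1 (fun f => f (gen _ w')) epsi.
  have := congr1 (fun f => f (gen _ w')) ephi.
  by rewrite /= tauE (tau_opE _ hop).
have tau_opx z : tau_op (lambda_rho lr) z (ts_xi (cfree X)) =
    \sum_(w <- msupp (repr z : {malg C[fp_word S]}))
      (repr z)@_w *: op_word (lambda_rho lr) (val w) (ts_xi (cfree X)).
  by rewrite /tau_op /plift /free_lift fct_sumE.
congr (_, _); apply/funext => z /=; rewrite tau_opx /tau /plift /free_lift !linear_sum /=;
  by apply: eq_bigr => w _; rewrite !linearZ /=; have [h1 h2] := h _ (valP w); congr (_ * _).
Qed.

End Representations.

(** * Moments of the c-free product *)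

Section MomentFormula.
Variables (C : fieldType) (A : algType C) (K : choiceType).
Variables (S : K -> side -> {pred A}) (phi psi : {scalar A}).
Hypotheses (phi1 : phi 1 = 1) (psi1 : psi 1 = 1).
Local Notation L := (fp_letter A K).
Local Notation kap := (on_word (K := K) (kappa psi)).
Local Notation th :=
  (fun w => on_word (K := K) (ckappa phi psi) w - on_word (K := K) (kappa psi) w).
Local Notation kfock := (fock (@colour C A K) (@letter_side C A K) kap).

Lemma moment_letters (f : A -> C) n (x : 'I_n -> L) :
  f (\prod_(t <- map x (enum 'I_n)) t.2) = moment f (fun i => letter_val (x i)).
Proof. by rewrite big_map /moment enumT [index_enum _]unlock. Qed.

Lemma coloured_partition k n (x : 'I_n -> L) P :
  coloured k (map x (enum 'I_n)) -> colour_partition (@colour C A K) x P.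
Proof.
rewrite /coloured all_map => /allP h; apply/colour_partitionP => V _ i j _ _.
by rewrite (eqP (h i _)) ?(eqP (h j _)) ?mem_enum.
Qed.

(** All partitions of a word of one colour are one-coloured, so the expansion is the full
    moment-cumulant formula. The empty word, outside that formula, is covered by unitality. *)
Lemma coloured_moments k (w : seq L) : coloured k w ->
  psi (\prod_(t <- w) t.2) = vac (kfock w) /\
  phi (\prod_(t <- w) t.2) = theta th (kfock w).
Proof.
have [->|w0] := eqVneq w [::].
  by rewrite big_nil phi1 psi1 rmorph1 -theta0 rmorph1.
have n0 : (0 < size w)%N by rewrite lt0n size_eq0.
have : exists x, w = map x (enum 'I_(size w)).
  by exists (tnth (in_tuple w)); rewrite map_tnth_enum.
case=> x; move: (size w) n0 x => n n0 x -> hw.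
rewrite !moment_letters vac_fock_kappa theta_fock_ckappa.
rewrite (kappa_moment_cumulant psi n0 (fun i => letter_side (x i))).
rewrite (ckappa_moment_cumulant phi psi n0 (fun i => letter_side (x i))).
by split; apply: eq_bigl => P; rewrite (coloured_partition _ hw) andbT.
Qed.

Section CFreeModel.
Variables (X : K -> two_state_space C).
Variable lr : forall k, side -> A -> {linear X k -> X k}.
Hypothesis local_dist : forall k w, admissible S w -> coloured k w ->
  ts_psi (local_word lr k w) = psi (\prod_(t <- w) t.2) /\
  ts_phi (X k) (local_word lr k w) = phi (\prod_(t <- w) t.2).

Lemma cfree_moments n (x : 'I_n -> L) : admissible S (map x (enum 'I_n)) ->
  ts_psi (op_word (lambda_rho lr) (map x (enum 'I_n)) (ts_xi (cfree X))) =
    \sum_(P in BNC (fun i => letter_side (x i)) | colour_partition (@colour C A K) x P)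
      kappa_term (kappa psi) (fun i => letter_side (x i)) (fun i => letter_val (x i)) P /\
  ts_phi (cfree X) (op_word (lambda_rho lr) (map x (enum 'I_n)) (ts_xi (cfree X))) =
    \sum_(P in BNC (fun i => letter_side (x i)) | colour_partition (@colour C A K) x P)
      ckappa_term (kappa psi) (ckappa phi psi)
        (fun i => letter_side (x i)) (fun i => letter_val (x i)) P.
Proof.
move=> hw; rewrite -vac_fock_kappa -theta_fock_ckappa.
have lpsi k w : admissible S w -> coloured k w -> ts_psi (local_word lr k w) = vac (kfock w).
  by move=> h1 h2; rewrite (local_dist h1 h2).1 (coloured_moments h2).1.
have lphi k w : admissible S w -> coloured k w ->
    ts_phi (X k) (local_word lr k w) = theta th (kfock w).
  by move=> h1 h2; rewrite (local_dist h1 h2).2 (coloured_moments h2).2.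
by split; [exact: (cfree_psi_fock lpsi)|exact: (cfree_phi_fock lpsi lphi)].
Qed.

End CFreeModel.

Definition mixed_vanish_below n : Prop :=
  forall m, (2 <= m < n)%N ->
  forall (chi : 'I_m -> side) (omega : 'I_m -> K) (a : 'I_m -> A),
    (forall i, a i \in S (omega i) (chi i)) ->
    ~ (exists k, forall i, omega i = k) ->
    kappa psi m chi a = 0 /\ ckappa phi psi m chi a = 0.

(** A block with two colours has at least two elements, and both its cumulants vanish, whether it is
    interior or exterior. The bound [m] is [n] for proper partitions in the induction, and [n.+1]
    once all mixed cumulants vanish. *)
Lemma mixed_term n (x : 'I_n -> L) (P : {set {set 'I_n}}) m :
  mixed_vanish_below m -> admissible S (map x (enum 'I_n)) ->
  (forall V, V \in P -> (#|V| < m)%N) ->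
  ~~ colour_partition (@colour C A K) x P ->
  kappa_term (kappa psi) (fun i => letter_side (x i)) (fun i => letter_val (x i)) P = 0 /\
  ckappa_term (kappa psi) (ckappa phi psi)
    (fun i => letter_side (x i)) (fun i => letter_val (x i)) P = 0.
Proof.
move=> hm; rewrite /admissible all_map => /allP hx hP.
rewrite negb_forall_in => /exists_inP[V VP].
rewrite negb_forall_in => /exists_inP[i iV].
rewrite negb_forall_in => /exists_inP[j jV ij].
have [|||k0 c0] := hm #|V| _ (Defs.restrict V (fun i => letter_side (x i)))
    (Defs.restrict V (fun i => colour (x i))) (Defs.restrict V (fun i => letter_val (x i))).
- rewrite hP // andbT; apply/card_gt1P; exists i, j; split=> //.
  by apply: contraNneq ij => ->.
- by move=> l; apply: hx; rewrite mem_enum.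
- case=> k hk; case/eqP: ij.
  have := hk (enum_rank_in jV j); rewrite -(hk (enum_rank_in iV i)) /Defs.restrict.
  by rewrite !enum_rankK_in.
split; first by rewrite /kappa_term (bigD1 V) //= k0 mul0r.
rewrite /ckappa_term; case: (boolP (interior_block (fun i => letter_side (x i)) P V)) => hV.
  by rewrite (bigD1 V) ?VP //= k0 !mul0r.
by rewrite [X in _ * X](bigD1 V) ?VP //= c0 mul0r mulr0.
Qed.

(** Comparison with the moment-cumulant formula shows that the partitions having a mixed block sum
    to zero; by induction each term but that of the one-block partition vanishes, hence so does this
    one. *)
Lemma moment_formula_mixed_vanish :
  (forall n (x : 'I_n -> L), admissible S (map x (enum 'I_n)) ->
    moment psi (fun i => letter_val (x i)) =
      \sum_(P in BNC (fun i => letter_side (x i)) | colour_partition (@colour C A K) x P)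
        kappa_term (kappa psi) (fun i => letter_side (x i)) (fun i => letter_val (x i)) P /\
    moment phi (fun i => letter_val (x i)) =
      \sum_(P in BNC (fun i => letter_side (x i)) | colour_partition (@colour C A K) x P)
        ckappa_term (kappa psi) (ckappa phi psi)
          (fun i => letter_side (x i)) (fun i => letter_val (x i)) P) ->
  forall n, mixed_vanish_below n.
Proof.
move=> hmom; elim=> [|n IH]; first by move=> m; rewrite andbF.
move=> m /andP[m2 mn] chi omega a ha hom.
have [mn'|nm] := ltnP m n; first by apply: (IH m) ha hom; rewrite m2.
have {nm mn} e : n = m by apply/eqP; rewrite eqn_leq nm -ltnS mn.
rewrite {n}e in IH; have m0 : (0 < m)%N by apply: ltn_trans m2.
pose x i : L := ((omega i, chi i), a i).
have hx : admissible S (map x (enum 'I_m)).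
  by rewrite /admissible all_map; apply/allP => i _; apply: ha.
set P0 := [set [set: 'I_m]].
have P0B : P0 \in BNC chi := one_block_BNC chi m0.
have P0c : ~~ colour_partition (@colour C A K) x P0.
  apply/negP => /colour_partitionP h; apply: hom.
  exists (omega (Ordinal m0)) => i.
  by apply: (h [set: 'I_m]); rewrite ?inE.
(* The one-coloured terms cancel, and among the others only [P0] has a block of full size. *)
have isolate (t : {set {set 'I_m}} -> C) :
    (forall P : {set {set 'I_m}}, (forall V, V \in P -> (#|V| < m)%N) ->
       ~~ colour_partition (@colour C A K) x P -> t P = 0) ->
    \sum_(P in BNC chi) t P =
      \sum_(P in BNC chi | colour_partition (@colour C A K) x P) t P -> t P0 = 0.
  move=> ht; rewrite (bigID (colour_partition (@colour C A K) x)) /=.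
  rewrite -[RHS]addr0 => /addrI; rewrite (bigD1 P0) ?P0B //= big1 ?addr0 //.
  move=> P /andP[/andP[PB Pc] PP0]; apply: ht => // V.
  exact: block_ltn PB PP0.
have [hpsi hphi] := hmom m x hx.
rewrite (kappa_moment_cumulant psi m0 chi) in hpsi.
rewrite (ckappa_moment_cumulant phi psi m0 chi) in hphi.
split.
  rewrite -(one_block_restrict (kappa psi) chi a).
  have := isolate _ _ hpsi; rewrite /kappa_term big_set1; apply=> P hP nc.
  by have [] := mixed_term IH hx hP nc.
rewrite -(ckappa_term_one (kappa psi) (ckappa phi psi) chi a).
apply: (isolate _ _ hphi) => P hP nc.
by have [] := mixed_term IH hx hP nc.
Qed.

End MomentFormula.

(** * The model by left multiplication *)

Section StandardSpace.
Variables (C : fieldType) (A : algType C) (phi psi : {scalar A}).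
Hypotheses (phi1 : phi 1 = 1) (psi1 : psi 1 = 1).

Definition lmul (a x : A) : A := a * x.
Fact lmul_is_linear a : linear (lmul a).
Proof. by move=> c x y; rewrite /lmul mulrDr scalerAr. Qed.
HB.instance Definition _ a := GRing.isLinear.Build C A A *:%R (lmul a) (lmul_is_linear a).

Definition ker_psi : {pred A} := fun x => psi x == 0.

Fact ker_psi_submod : submod_closed ker_psi.
Proof.
split=> [|c x y]; rewrite /in_mem /= /ker_psi ?linear0 // linearP /=.
by move=> /eqP -> /eqP ->; rewrite mulr0 addr0.
Qed.

Fact ker_psi_direct (x : A) : exists! c : C, x - c *: 1 \in ker_psi.
Proof.
have h c : (x - c *: 1 \in ker_psi) = (psi x == c).
  by rewrite /in_mem /= /ker_psi linearB linearZ /= psi1 mulr1 subr_eq0.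
by exists (psi x); split=> [|c]; rewrite h // => /eqP.
Qed.

(** Both faces of a pair of algebras act on [A] by left multiplication, with
    state-vector [1]; this model is used for every index. *)
Definition standard_space : two_state_space C :=
  @TwoStateSpace C A ker_psi 1 phi ker_psi_submod (oner_neq0 A) ker_psi_direct phi1.

Definition standard_rep (a : A) : {linear standard_space -> standard_space} := lmul a.

Lemma standard_psi (x : standard_space) : ts_psi x = psi x.
Proof.
apply: ts_psi_uniq.
by rewrite /in_mem /= /ker_psi /= linearB linearZ /= psi1 mulr1 subrr.
Qed.

End StandardSpace.

(** * Equivalence of the two notions of independence *)

Theorem theorem4p1 (R : realType) (A : algType R[i])
    (phi psi : {scalar A}) (phi1 : phi 1 = 1) (psi1 : psi 1 = 1)
    (K : choiceType) (S : K -> side -> {pred A})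
    (S_subalg : forall k s, subalg_closed (S k s)) :
  c_bi_free S phi psi <-> comb_c_bi_free S phi psi.
Proof.
split=> [[X [lr [hlr /(op_pair_distributionP phi psi hlr) hdist]]]|hcomb].
  (* Words of a single colour stay in the copy of [X k], so the joint distribution determines the
     distribution in each [X k]. *)
  have local_dist k w : admissible S w -> coloured k w ->
      ts_psi (local_word lr k w) = psi (\prod_(t <- w) t.2) /\
      ts_phi (X k) (local_word lr k w) = phi (\prod_(t <- w) t.2).
    move=> hw hk; have [-> ->] := hdist w hw.
    by rewrite (op_word_coloured lr hk); have [-> ->] := Vmap_xi (local_word lr k w).
  have hmix := moment_formula_mixed_vanish (S := S) (phi := phi) (psi := psi).
  (* The bound in [mixed_vanish_below] is strict, so [n.+1] covers order [n]. *)
  move=> n n2 chi omega a ha hom; apply: (hmix _ n.+1) ha hom; last by rewrite n2 /=.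
  move=> m x hx; have [<- <-] := cfree_moments phi1 psi1 local_dist hx.
  by have [<- <-] := hdist _ hx; rewrite !moment_letters.
pose X (k : K) := standard_space phi1 psi1.
pose lr (k : K) (s : side) (a : A) : {linear X k -> X k} := standard_rep phi1 psi1 a.
have lw k w : local_word lr k w = \prod_(t <- w) t.2.
  by elim: w => [|t w IH]; rewrite ?big_nil // big_cons /= IH.
have hlr k s : unital_hom (S k s) (lr k s).
  split=> [x|a b _ _ x|c a b _ _ x]; first exact: mul1r.
    exact/esym/mulrA.
  by rewrite /= /lmul mulrDl scalerAl.
exists X, lr; split=> //; apply/op_pair_distributionP => // w hw.
(* The moment-cumulant formulas start at order one; the empty word is handled by unitality. *)
have [w0|w0] := eqVneq w [::].
  rewrite w0 big_nil phi1 psi1.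
  by split; symmetry; [exact: ts_phi_xi|exact: ts_psi_xi].
have n0 : (0 < size w)%N by rewrite lt0n size_eq0.
have : exists x, w = map x (enum 'I_(size w)).
  by exists (tnth (in_tuple w)); rewrite map_tnth_enum.
case=> x; move: (size w) n0 x hw {w0} => n n0 x hw ew; rewrite {w}ew in hw *.
have [|-> ->] := cfree_moments (S := S) phi1 psi1 (X := X) (lr := lr) _ hw.
  by move=> k v _ _; rewrite lw standard_psi.
rewrite !moment_letters.
rewrite (kappa_moment_cumulant psi n0 (fun i => letter_side (x i))).
rewrite (ckappa_moment_cumulant phi psi n0 (fun i => letter_side (x i))).
have mix : mixed_vanish_below S phi psi n.+1.
  by move=> m /andP[m2 _]; apply: hcomb.
have small (P : {set {set 'I_n}}) V : V \in P -> (#|V| < n.+1)%N.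
  by move=> _; rewrite ltnS -[n in (_ <= n)%N]card_ord max_card.
(* Vanishing mixed cumulants reduce the moment-cumulant sums to one-coloured partitions, which are
   the moments of the c-free product. *)
split; rewrite [LHS](bigID (colour_partition (@colour _ A K) x)) /=
  [X in _ + X]big1 ?addr0 // => P /andP[_ nc].
  by have [] := mixed_term mix hw (small P) nc.
by have [] := mixed_term mix hw (small P) nc.
Qed.
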